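(* The $\ell^1$-Heisenberg group (resp. the $\ell^\infty$-Heisenberg group) equipped with the Lebesgue measure does not satisfy $\mathsf{MCP}(K,N)$ for any $K\in\mathbb{R}$ and any $N\ge1$ (for which $\mathsf{MCP}(K,N)$ is defined). Its geodesic dimension is $4$, that is, the same as its Hausdorff dimension.
   Context: **The $\ell^p$-Heisenberg group, $p\in\{1,\infty\}$.** The Heisenberg group $\mathbb{H}$ is $\mathbb{R}^3$ with group law $(x,y,z)\cdot(x',y',z')=(x+x',y+y',z+z'+\frac12(xy'-x'y))$ and left-invariant vector fields $X=\partial_x-\frac y2\partial_z$, $Y=\partial_y+\frac x2\partial_z$. An absolutely continuous curve $\gamma:[0,1]\to\mathbb{H}$ is horizontal if $\dot\gamma(t)=u_1(t)X(\gamma(t))+u_2(t)Y(\gamma(t))$ for a.e. $t$; its length is $\mathrm{L}(\gamma)=\int_0^1\|(u_1,u_2)\|_p\,dt$, where $\|(u_1,u_2)\|_1=|u_1|+|u_2|$ and $\|(u_1,u_2)\|_\infty=\max(|u_1|,|u_2|)$. The distance $d(g_0,g_1)$ is the infimum of the lengths of horizontal curves joining $g_0$ to $g_1$. The measure is the Lebesgue measure $\mathcal{L}^3$ on $\mathbb{R}^3$. **Measure contraction property (general definition, Ohta).** Let $(X,d,\mathfrak{m})$ be a geodesic metric measure space, $\Gamma$ the set of constant speed minimising geodesics $\gamma:[0,1]\to X$, $e_t(\gamma)=\gamma(t)$, and $\ell(\gamma)=d(\gamma(0),\gamma(1))$. Let $\mathsf{s}_K(t)=\sin(\sqrt Kt)/\sqrt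 K$ if $K>0$, $\mathsf{s}_0(t)=t$, $\mathsf{s}_K(t)=\sinh(\sqrt{-K}t)/\sqrt{-K}$ if $K<0$. Let $K\in\mathbb{R}$ and $N>1$, or $K\le0$ and $N=1$ ($\mathsf{MCP}(K,N)$ is defined only for such pairs). The space satisfies $\mathsf{MCP}(K,N)$ if for every $x\in X$ and every Borel set $A\subseteq X$ with $0<\mathfrak{m}(A)<+\infty$ (and $A\subseteq B(x,\pi\sqrt{(N-1)/K})$ if $K>0$) there is a Borel probability measure $\Pi$ on $\Gamma$ such that $(e_0)_*\Pi=\delta_x$, $(e_1)_*\Pi=\mathfrak{m}(A)^{-1}\mathfrak{m}|_A$ and, for all $t\in[0,1]$, $$d\mathfrak{m}\ \ge\ (e_t)_*\left(t\left[\frac{\mathsf{s}_K(t\,\ell(\gamma)/\sqrt{N-1})}{\mathsf{s}_K(\ell(\gamma)/\sqrt{N-1})}\right]^{N-1}\mathfrak{m}(A)\,d\Pi(\gamma)\right),$$ with conventions $0/0=1$ and the bracket to the power $N-1$ equal to $1$ if $K\le0$ and $N=1$. **Geodesic dimension.** For $x\in X$, a Borel set $\Omega\subseteq X$ and $t\in[0,1]$, the $t$-intermediate set of $\Omega$ from $x$ is $\Omega_t=\{\gamma(t)\mid\gamma\in\Gamma,\ \gamma(0)=x,\ \gamma(1)\in\Omega\}$. For $s>0$ let $$C_s(x)=\sup\left\{\limsup_{t\to0^+}\frac1{t^s}\frac{\mathfrak{m}(\Omega_t)}{\mathfrak{m}(\Omega)}\ \Big|\ \Omega\text{ Borel, bounded,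 }\mathfrak{m}(\Omega)\in(0,\infty)\right\}.$$ The geodesic dimension at $x$ is $N_{\mathrm{geo}}(x)=\inf\{s>0\mid C_s(x)=+\infty\}=\sup\{s>0\mid C_s(x)=0\}$, and $N_{\mathrm{geo}}=\sup_{x\in X}N_{\mathrm{geo}}(x)$. *)

(* Defs.v *)
From HB Require Import structures.
From mathcomp Require Import all_boot all_order all_algebra.
From mathcomp Require Import all_classical all_reals all_analysis.
From mathcomp Require Import ring.

Set Implicit Arguments.
Unset Strict Implicit.
Unset Printing Implicit Defensive.

Import Order.TTheory GRing.Theory Num.Theory.
Import numFieldNormedType.Exports.

Local Open Scope classical_set_scope.
Local Open Scope ring_scope.

(* Conventions for the general notions.  A metric measure space is given by a
   measurableType X, a distance d : X -> X -> R and a measure m on X; the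
   measurable sets of X are meant to be the Borel sets of d.  This is the case
   below: X = R^3 carries its usual Borel sigma-algebra, and the distance of
   the Heisenberg group induces the Euclidean topology. *)

(** Geodesics *)

(* Constant speed minimising geodesics parametrised by [0, 1].  A map
   [0, 1] -> X is represented by its extension to R that is constant on
   ]-oo, 0] and on [1, +oo[, so that equality of elements of [geodesics d] is
   equality on [0, 1]. *)
Definition geodesics (R : realType) (X : Type) (d : X -> X -> R) :
    set (R -> X) :=
  [set g | (forall s t : R, 0 <= s <= 1 -> 0 <= t <= 1 ->
             d (g s) (g t) = `|t - s| * d (g 0) (g 1)) /\
           (forall t : R, g t = g (Num.max 0 (Num.min t 1)))].

(* Open sets of the topology of uniform convergence. *)
Definition geodesics_open (R : realType) (X : Type) (d : X -> X -> R) :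
    set (set (geodesics d)) :=
  [set U | forall g, U g -> exists2 e : R, 0 < e &
     forall h : geodesics d,
       (forall t : R, 0 <= t <= 1 -> d (val g t) (val h t) < e) -> U h].

(* The type of geodesics with its Borel sigma-algebra.  The library requires a
   measurableType to be pointed, so the type is parametrised by an element g0,
   which plays no other role: it does not enter the sigma-algebra. *)
Definition geodesic_space (R : realType) (X : Type) (d : X -> X -> R)
  (g0 : geodesics d) : Type := geodesics d.

HB.instance Definition _ (R : realType) (X : Type) (d : X -> X -> R)
  (g0 : geodesics d) := gen_eqMixin (geodesic_space g0).
HB.instance Definition _ (R : realType) (X : Type) (d : X -> X -> R)
  (g0 : geodesics d) := gen_choiceMixin (geodesic_space g0).
HB.instance Definition _ (R : realType) (X : Type) (d : X -> X -> R)
  (g0 : geodesics d) := isPointed.Build (geodesic_space g0) g0.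

Definition borel_geodesics (R : realType) (X : Type) (d : X -> X -> R)
    (g0 : geodesics d) :=
  g_sigma_algebraType (@geodesics_open R X d : set (set (geodesic_space g0))).

Definition eval_at (R : realType) (X : Type) (d : X -> X -> R) (t : R)
  (g : geodesics d) : X := val g t.

Definition geodesic_length (R : realType) (X : Type) (d : X -> X -> R)
  (g : geodesics d) : R := d (eval_at 0 g) (eval_at 1 g).

(** Measure contraction property *)

Definition MCP_pair (R : realType) (K N : R) : Prop :=
  1 < N \/ (K <= 0 /\ N = 1).

Definition sK (R : realType) (K t : R) : R :=
  if 0 < K then sin (Num.sqrt K * t) / Num.sqrt K
  else if K == 0 then t
  else (expR (Num.sqrt (- K) * t) - expR (- (Num.sqrt (- K) * t))) / 2
       / Num.sqrt (- K).

(* [sK (t l / sqrt (N-1)) / sK (l / sqrt (N-1))]^(N-1), with 0/0 = 1, and with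
   value 1 when N = 1.  The denominator is positive for 0 < l (and
   l < pi sqrt ((N-1)/K) if 0 < K), the only values that occur below. *)
Definition MCP_bracket (R : realType) (K N t l : R) : R :=
  if N == 1 then 1 else
  let a := sK K (t * l / Num.sqrt (N - 1)) in
  let b := sK K (l / Num.sqrt (N - 1)) in
  (if (a == 0) && (b == 0) then 1 else a / b) `^ (N - 1).

Definition MCP (disp : measure_display) (R : realType)
    (X : measurableType disp) (d : X -> X -> R)
    (m : {measure set X -> \bar R}) (K N : R) : Prop :=
  forall (x : X) (A : set X),
    measurable A -> (0 < m A < +oo)%E ->
    (0 < K -> A `<=` [set y | d x y < pi * Num.sqrt ((N - 1) / K)]) ->
  exists (g0 : geodesics d) (P : probability (borel_geodesics g0) R),
  [/\ forall B : set X, measurable B ->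
        pushforward P (eval_at 0) B = dirac x B,
      forall B : set X, measurable B ->
        pushforward P (eval_at 1) B = ((m A)^-1 * m (B `&` A))%E
    & forall t : R, 0 <= t <= 1 -> forall B : set X, measurable B ->
        (\int[P]_(g in eval_at t @^-1` B)
           ((t * MCP_bracket K N t (geodesic_length g))%:E * m A)
         <= m B)%E].

(** Geodesic dimension *)

Definition intermediate_set (R : realType) (X : Type) (d : X -> X -> R)
    (x : X) (Om : set X) (t : R) : set X :=
  [set g t | g in [set g | [/\ geodesics d g, g 0 = x & Om (g 1)]]].

(* An intermediate set of a Borel set is a continuous image of a Borel set of
   geodesics, hence measurable for the completion of m but possibly not Borel;
   its measure is taken with the outer measure of m, which extends the
   completion. *)
Definition geodesic_C (disp : measure_display) (R : realType)
    (X : measurableType disp) (d : X -> X -> R)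
    (m : {measure set X -> \bar R}) (x : X) (s : R) : \bar R :=
  ereal_sup
    [set limf_esup
           (fun t : R => ((t `^ s)^-1%:E *
             ((m^*)%mu (intermediate_set d x Om t) * (m Om)^-1))%E)
           0^'+
    | Om in [set Om : set X |
        [/\ measurable Om,
            exists M : R, forall y z, Om y -> Om z -> d y z <= M
          & (0 < m Om < +oo)%E]]].

Definition geodesic_dim_at (disp : measure_display) (R : realType)
    (X : measurableType disp) (d : X -> X -> R)
    (m : {measure set X -> \bar R}) (x : X) : \bar R :=
  ereal_inf [set s%:E | s in [set s : R | 0 < s /\ geodesic_C d m x s = +oo%E]].

Definition geodesic_dim (disp : measure_display) (R : realType)
    (X : measurableType disp) (d : X -> X -> R)
    (m : {measure set X -> \bar R}) : \bar R :=
  ereal_sup (range (geodesic_dim_at d m)).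

(** Hausdorff dimension *)

(* The diameter, with value 0 on the empty set. *)
Definition ediam (R : realType) (X : Type) (d : X -> X -> R) (U : set X) :
    \bar R :=
  ereal_sup ([set (d yz.1 yz.2)%:E | yz in U `*` U] `|` [set 0%E]).

Definition hausdorff_premeasure (R : realType) (X : Type) (d : X -> X -> R)
    (s delta : R) (A : set X) : \bar R :=
  ereal_inf
    [set (\sum_(i <oo) (ediam d (U i)) `^ s)%E
    | U in [set U : nat -> set X |
        A `<=` \bigcup_i U i /\ forall i, (ediam d (U i) <= delta%:E)%E]].

Definition hausdorff_measure (R : realType) (X : Type) (d : X -> X -> R)
    (s : R) (A : set X) : \bar R :=
  ereal_sup
    [set hausdorff_premeasure d s delta A | delta in [set e : R | 0 < e]].

Definition hausdorff_dim (R : realType) (X : Type) (d : X -> X -> R) : \bar R :=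
  ereal_inf
    [set s%:E | s in [set s : R | 0 < s /\ hausdorff_measure d s setT = 0%E]].

(** The Heisenberg group *)

(* R^3; [measurableTypeR R] is R with the Borel sigma-algebra on which
   [lebesgue_measure] is defined. *)
Definition heis (R : realType) :=
  (measurableTypeR R * measurableTypeR R * measurableTypeR R)%type.

Definition heis_mul (R : realType) (g h : heis R) : heis R :=
  let: (x, y, z) := g in let: (x', y', z') := h in
  (x + x', y + y', z + z' + 2^-1 * (x * y' - x' * y)).

Definition heisX (R : realType) (g : heis R) : heis R := (1, 0, - (g.1.2 / 2)).
Definition heisY (R : realType) (g : heis R) : heis R := (0, 1, g.1.1 / 2).

(* [heisX] and [heisY] are the left-invariant fields of the group law that are
   equal to d/dx and d/dy at the origin. *)
Lemma heisX_left_invariant (R : realType) (g : heis R) (s : R) :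
  heis_mul g (s, 0, 0) = g + s *: heisX g.
Proof.
case: g => [[x y] z]; congr (_, _, _); rewrite /= /GRing.scale /=.
- by rewrite mulr1.
- by rewrite mulr0.
- by field.
Qed.

Lemma heisY_left_invariant (R : realType) (g : heis R) (s : R) :
  heis_mul g (0, s, 0) = g + s *: heisY g.
Proof.
case: g => [[x y] z]; congr (_, _, _); rewrite /= /GRing.scale /=.
- by rewrite mulr0.
- by rewrite mulr1.
- by field.
Qed.

Definition absolutely_continuous01 (R : realType) (V : normedModType R)
    (f : R -> V) : Prop :=
  forall e : R, 0 < e -> exists2 delta : R, 0 < delta &
  forall (n : nat) (a b : 'I_n -> R),
    (forall i, [/\ 0 <= a i, a i <= b i & b i <= 1]) ->
    trivIset setT (fun i => `]a i, b i[%classic) ->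
    \sum_(i < n) (b i - a i) < delta ->
    \sum_(i < n) `|f (b i) - f (a i)| < e.

(* g is a horizontal curve with control (u1, u2); only the values on [0, 1]
   matter. *)
Definition horizontal (R : realType) (g : R -> heis R) (u1 u2 : R -> R) :
    Prop :=
  [/\ absolutely_continuous01 g,
      measurable_fun (`[0, 1]%classic : set R) u1,
      measurable_fun (`[0, 1]%classic : set R) u2
    & {ae lebesgue_measure, forall t : R, 0 <= t <= 1 ->
        is_derive t 1 g (u1 t *: heisX (g t) + u2 t *: heisY (g t))}].

Variant exponent1oo := Exponent1 | Exponentoo.

Definition norm_p (R : realType) (p : exponent1oo) (a b : R) : R :=
  match p with
  | Exponent1 => `|a| + `|b|
  | Exponentoo => Num.max `|a| `|b|
  end.

Definition curve_length (R : realType) (p : exponent1oo) (u1 u2 : R -> R) :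
    \bar R :=
  (\int[lebesgue_measure]_(t in (`[0%R, 1%R]%classic : set R))
     (norm_p p (u1 t) (u2 t))%:E)%E.

(* The infimum is finite, as any two points are joined by a horizontal curve of
   finite length. *)
Definition heis_dist (R : realType) (p : exponent1oo) (g0 g1 : heis R) : R :=
  fine (ereal_inf
    [set l | exists (g : R -> heis R) (u1 u2 : R -> R),
       [/\ horizontal g u1 u2, g 0 = g0, g 1 = g1 & l = curve_length p u1 u2]]).

Definition heis_lebesgue (R : realType) : {measure set (heis R) -> \bar R} :=
  (lebesgue_measure \x lebesgue_measure \x lebesgue_measure)%E.

(* Main.v *)
(* The linear map (x, y) |-> ((x + y) / 2, (x - y) / 2), lifted to the group,
   turns the oo-distance into the 1-distance, so only the 1-distance from the
   origin has to be estimated.  Along an admissible curve w = z + x y / 2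
   satisfies w' = x y'; writing V1, V2 for the variations of x and y and m, M
   for the extrema of x, this gives |w| <= V1 V2 and
   w <= (M + m) / 2 * Y + (M - m) / 2 * V2, and these two inequalities are the
   only lower bounds on lengths that are needed.

   The 1-norm is not strictly convex, so minimisers branch.  To a point (X, Y, Z)
   with 0 < X << Y and X Y / 2 < Z the distance is exactly Y + 2 Z / Y, and
   feeding this value into the equality case of the triangle inequality shows
   that every geodesic from 0 to such a point starts along the x-axis.  For small
   t the geodesics to an open set of such endpoints are thus at time t in the
   null set {z = 0}, while MCP(K, N) would give that set positive measure.

   Conversely, the monotone staircases x, then y, then x again, are minimising
   and may be prolonged by straight lines: the points reached at time t by
   geodesics to a fixed box fill a set of volume at least c t^4.  Together with
   the fact that balls of radius r have volume comparable to r^4 this yields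
   both dimensions. *)

Require Import Defs.
From HB Require Import structures.
From mathcomp Require Import all_boot all_order all_algebra.
From mathcomp Require Import all_classical all_reals all_analysis.
From mathcomp Require Import ring lra measurable_realfun.

Set Implicit Arguments.
Unset Strict Implicit.
Unset Printing Implicit Defensive.

Import Order.TTheory GRing.Theory Num.Theory.
Import numFieldNormedType.Exports.

Local Open Scope classical_set_scope.
Local Open Scope ring_scope.

(** * Absolutely continuous functions *)

(** The two lower bounds play opposite roles. By the first, the area swept by an initial piece of
    norm r is at most r times its excess r - |x| over the horizontal displacement: this is of second
    order. The second bound, applied to the displacement that remains, shows that the same excess
    costs length at first order. Once r is at most 1/100 of the scale of the target, the two are
    compatible only if the excess vanishes, and then y = 0 and z = 0. Lower bounds are taken along
    almost minimising curves and upper bounds come from explicit concatenations of segments.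
    Horizontal curves being merely absolutely continuous, the lower bounds rest on the fundamental
    theorem of calculus in that class, hence on the fact that an absolutely continuous function with
    derivative 0 almost everywhere is constant. On the space of geodesics only two kinds of events
    are shown to be Borel, starting at the origin and ending in a given closed box; the contraction
    integral is bounded below by a simple function supported on their intersection. *)

Section absolute_continuity.
Variable R : realType.
Notation mu := (@lebesgue_measure R).

(** Points satisfying [P] accumulate from the left at the supremum [T] of all of them (or reach it);
    the step carries [P] from one of these across [T], strictly beyond it unless [T = c]. *)
Lemma interval_induction (c : R) (P : R -> Prop) : 0 <= c -> P 0 ->
  (forall T : R, 0 <= T <= c -> exists2 r : R, 0 < r & forall t t' : R, 0 <= t -> t <= T ->
     T <= t' -> t' <= c -> T - r < t -> t' < T + r -> P t -> P t') ->
  P c.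
Proof.
move=> c0 P0 step; pose S := [set t | 0 <= t <= c /\ P t].
have S0 : S 0 by split=> //; rewrite lexx.
have supS : has_sup S.
  by split; [exists 0 | exists c => t [/andP[]]].
have T0 : 0 <= sup S by exact: ub_le_sup supS.2 _ S0.
have Tc : sup S <= c by apply: ge_sup => [|t [/andP[]]]; first by exists 0.
have [|r r0 H] := step (sup S); first by rewrite T0.
have [t St tr] := sup_adherent r0 supS.
have tT : t <= sup S by exact: ub_le_sup supS.2 _ St.
case: St => /andP[t0 tc] Pt.
pose t' := Num.min c (sup S + r / 2).
have Tt' : sup S <= t' by rewrite le_min Tc lerDl ltW// divr_gt0.
have t'c : t' <= c by rewrite ge_min lexx.
have Pt' : P t'.
  apply: (H t) => //; rewrite /t' gt_min; apply/orP; right; lra.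
have St' : S t' by split=> //; rewrite t'c (le_trans T0).
have t'T : t' <= sup S by exact: ub_le_sup supS.2 _ St'.
move: t'T Pt'; rewrite {1}/t' ge_min => /orP[cT|]; last by lra.
by rewrite (_ : t' = c)//; apply/eqP; rewrite eq_le t'c (le_trans cT).
Qed.

Lemma lebesgue_measure_open_intervals n (a b : 'I_n -> R) :
  (forall i, a i <= b i) ->
  trivIset setT (fun i => `]a i, b i[%classic) ->
  mu (\big[setU/set0]_(i < n) `]a i, b i[%classic) =
  (\sum_(i < n) (b i - a i))%:E.
Proof.
move=> ab tab; rewrite measure_bigsetU_ord//.
rewrite -sumEFin; apply: eq_bigr => i _.
rewrite -[LHS]/(mu `]a i, b i[%classic) lebesgue_measure_itv/= lte_fin lt_neqAle ab andbT.
by case: eqP => [->|_]; rewrite ?subrr// EFinB.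
Qed.

Lemma le_lebesgue_measure_open_intervals n (a b : 'I_n -> R) (U : set R) :
  measurable U -> (forall i, a i <= b i) ->
  (forall i, `]a i, b i[ `<=` U) ->
  trivIset setT (fun i => `]a i, b i[%classic) ->
  ((\sum_(i < n) (b i - a i))%:E <= mu U)%E.
Proof.
move=> mO ab abO tab; rewrite -lebesgue_measure_open_intervals//.
apply: le_measure; rewrite ?inE//.
  by apply: bigsetU_measurable => i _; exact: measurable_itv.
by elim/big_ind: _ => [x //|A B AO BO x [/AO|/BO]|i _]//; exact: abO.
Qed.

(* Continuous induction on [t]: away from the exceptional null set [N] the function
   [h] grows at rate at most [e / 2]; an open cover of [N] of small measure
   contains the remaining increments, which absolute continuity bounds. *)
Lemma ac01_derive0 (h : R -> R) : absolutely_continuous01 h ->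
  {ae mu, forall t : R, 0 <= t <= 1 -> is_derive t 1 h 0} ->
  forall t : R, 0 <= t <= 1 -> h t = h 0.
Proof.
move=> ach dh c /andP[c0 c1].
suff H (e : R) : 0 < e -> `|h c - h 0| <= e.
  by apply/eqP; rewrite -subr_eq0 -normr_le0; apply/ler_addgt0Pl => e /H; rewrite addr0.
move=> e0; have e20 : 0 < e / 2 by rewrite divr_gt0.
have [d d0 acd] := ach _ e20.
have [N [mN N0 dN]] := dh.
have muN : (mu N < +oo)%E by rewrite N0.
have [U [oO NO muO]] := lebesgue_regularity_outer mN muN d0.
have mO : measurable U by exact: open_measurable.
have {}muO : (mu U < d%:E)%E.
  rewrite -(setDUK NO) measureU//; last exact: setDIK.
  - by rewrite [X in (X + _ < _)%E]N0 add0e.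
  - exact: measurableD.
(* [s] lists from left to right the intervals inside [U] used to step across points of [N]; the term
   [e / 2 * t] pays for the steps across the other points. *)
pose P (t : R) := exists s : seq (R * R),
  [/\ {in s, forall p : R * R, [/\ 0 <= p.1, p.1 <= p.2, p.2 <= t & `]p.1, p.2[ `<=` U]},
      pairwise (fun p q : R * R => p.2 <= q.1) s
    & `|h t - h 0| <= e / 2 * t + \sum_(p <- s) `|h p.2 - h p.1| ].
suff [s [sO ps hs]] : P c.
  apply: (le_trans hs); rewrite [leRHS]splitr lerD//.
    by rewrite ler_piMr// ltW.
  have ts : trivIset [set: 'I_(size s)] (fun i => `](nth 0 s i).1, (nth 0 s i).2[%classic).
    move=> i j _ _ [x [/=]]; rewrite !in_itv/= => /andP[ix xi] /andP[jx xj].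
    apply/val_inj/eqP => /=; apply/negPn/negP; rewrite neq_ltn => /orP[] ij.
      have /(_ i j (ltn_ord i) (ltn_ord j) ij) := (pairwiseP 0 ps).
      by apply/negP; rewrite -ltNge (lt_trans jx).
    have /(_ j i (ltn_ord j) (ltn_ord i) ij) := (pairwiseP 0 ps).
    by apply/negP; rewrite -ltNge (lt_trans ix).
  have {}sO i : [/\ 0 <= (nth 0 s i).1, (nth 0 s i).1 <= (nth 0 s i).2,
      (nth 0 s i).2 <= 1 & `](nth 0 s i).1, (nth 0 s i).2[ `<=` U].
    have [si|si] := ltnP i (size s).
      have [|? ? pc ?] := sO (nth 0 s i); first exact: mem_nth.
      by split=> //; exact: le_trans pc _.
    rewrite nth_default//; split=> //= x /=.
    by rewrite in_itv/= => /andP[x0 /(lt_trans x0)]; rewrite ltxx.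
  rewrite (big_nth 0) big_mkord ltW//; apply: acd => //.
  - by move=> i; have [] := sO i.
  - rewrite -lte_fin; apply: le_lt_trans muO.
    by apply: le_lebesgue_measure_open_intervals => // i; have [] := sO i.
apply: (interval_induction c0); first by exists [::]; split=> //;
  rewrite subrr normr0 mulr0 big_nil addr0.
move=> T /andP[T0 Tc].
have [dT|ndT] := pselect (is_derive T 1 h 0).
  have /is_derive1_caratheodory[g [hg cg g0]] := dT.
  have /cvgrPdist_lt/(_ _ e20) := cg; rewrite g0 => /nbhs_ballP[r /= r0 gr].
  have {hg}gr x : `|x - T| < r -> `|h x - h T| <= e / 2 * `|x - T|.
    move=> xT; rewrite hg normrM ler_wpM2r// -normrN -sub0r ltW//.
    by apply: gr; rewrite /ball/= distrC.
  exists r => // t t' t0 tT Tt' t'c tr t'r [s [sO ps hs]].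
  exists s; split=> // [p /sO[p0 p12 pt pO]|].
    by split=> //; apply: le_trans pt _; exact: le_trans tT _.
  have := gr t; have := gr t'.
  rewrite (ler0_norm (_ : t - T <= 0)) ?subr_le0// ger0_norm ?subr_ge0// !opprB.
  move=> /(_ _)/wrap[|ht']; first by lra.
  move=> /(_ _)/wrap[|ht]; first by lra.
  have -> : h t' - h 0 = (h t' - h T) + (h T - h t) + (h t - h 0) by ring.
  rewrite (le_trans (ler_normD _ _))//.
  have := ler_normD (h t' - h T) (h T - h t); rewrite (distrC (h T)) => ?.
  move: hs ht ht'; set S := \sum_(_ <- _) _ => ? ? ?; lra.
have {ndT}/NO : N T.
  by apply: dN => /= dT; apply: ndT; apply: dT; rewrite T0 (le_trans Tc).
rewrite openE in oO; move=> /oO/nbhs_ballP[r /= r0 rO].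
exists r => // t t' t0 tT Tt' t'c tr t'r [s [sO ps hs]].
have tt' : t <= t' by exact: le_trans tT _.
exists (rcons s (t, t')); split=> [p||].
- rewrite mem_rcons inE => /predU1P[->|/sO[p0 p12 pt pO]].
    split=> //= x /=; rewrite in_itv/= => /andP[tx xt']; apply: rO.
    by rewrite /ball/= ltr_norml; apply/andP; split; lra.
  by split=> //; exact: le_trans tt'.
- by rewrite pairwise_rcons ps andbT; apply/allP => p /sO[].
- rewrite -cats1 big_cat big_seq1 addrA /=.
  rewrite (_ : h t' - h 0 = (h t - h 0) + (h t' - h t)); last by ring.
  rewrite (le_trans (ler_normD _ _))// lerD2r (le_trans hs)// lerD2r.
  by rewrite ler_wpM2l// ltW.
Qed.

(** The single closure property from which pairs, linear combinations and products are obtained: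
    only increments are compared, and the three target spaces may differ. *)
Lemma ac01_le (V W X : normedModType R) (C : R) (g : R -> V) (k : R -> W) (f : R -> X) :
  0 <= C -> absolutely_continuous01 g -> absolutely_continuous01 k ->
  (forall a b : R, 0 <= a -> a <= b -> b <= 1 ->
    `|f b - f a| <= C * (`|g b - g a| + `|k b - k a|)) ->
  absolutely_continuous01 f.
Proof.
move=> C0 acg ack fle e e0.
have d0 : 0 < e / (2 * (C + 1)) by rewrite divr_gt0// mulr_gt0// ltr_wpDl.
have [d1 d10 h1] := acg _ d0; have [d2 d20 h2] := ack _ d0.
exists (Num.min d1 d2) => [|n a b ab tab]; first by rewrite lt_min d10.
rewrite lt_min => /andP[/(h1 _ _ _ ab tab) s1 /(h2 _ _ _ ab tab) s2].
apply: (@le_lt_trans _ _ (C * (\sum_(i < n) `|g (b i) - g (a i)| + \sum_(i < n) `|k (b i)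
  - k (a i)|))).
  rewrite -big_split/= mulr_sumr ler_sum// => i _.
  by have [a0 aib b1] := ab i; exact: fle.
apply: (@le_lt_trans _ _ (C * (e / (C + 1)))).
  rewrite ler_wpM2l// (_ : e / (C + 1) = e / (2 * (C + 1)) + e / (2 * (C + 1))).
    by rewrite ltW// ltrD.
  by field; rewrite gt_eqF//=; lra.
by rewrite mulrCA gtr_pMr// ltr_pdivrMr; lra.
Qed.

Lemma ac01_lipschitz (V : normedModType R) (C : R) (f : R -> V) :
  (forall a b : R, 0 <= a -> a <= b -> b <= 1 -> `|f b - f a| <= C * (b - a)) ->
  absolutely_continuous01 f.
Proof.
move=> fle e e0.
have C0 : 0 <= C.
  by have := fle _ _ (lexx 0) ler01 (lexx _); rewrite subr0 mulr1; apply: le_trans.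
exists (e / (C + 1)) => [|n a b ab tab sd]; first by rewrite divr_gt0// ltr_wpDl.
apply: (@le_lt_trans _ _ (C * \sum_(i < n) (b i - a i))).
  by rewrite mulr_sumr ler_sum// => i _; have [] := ab i; exact: fle.
apply: (@le_lt_trans _ _ (C * (e / (C + 1)))); first by rewrite ler_wpM2l// ltW.
by rewrite mulrCA gtr_pMr// ltr_pdivrMr; lra.
Qed.

(** The increments over disjoint intervals add up to at most the integral of |u| over their union,
    which is small with the measure of the union. *)
Lemma ac01_integral (u : R -> R) : mu.-integrable setT (EFin \o u) ->
  absolutely_continuous01 (fun x : R => \int[mu]_(t in `]-oo, x]) u t).
Proof.
move=> iu e /(integral_normr_continuous iu)[d [d0 hd]].
exists d => // n a b ab tab sd.
have aleb i : a i <= b i by have [] := ab i.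
pose D := \big[setU/set0]_(i < n) `]a i, b i[%classic.
have mD : measurable D.
  by apply: bigsetU_measurable => i _; exact: measurable_itv.
have iE A : measurable A -> mu.-integrable A (EFin \o (Num.norm \o u)).
  by move=> mA; apply: integrableS (integrable_norm iu).
apply: le_lt_trans (hd D mD _); last first.
  suff: (mu D < d%:E)%E by [].
  by rewrite /D lebesgue_measure_open_intervals// lte_fin.
have -> : \int[mu]_(x in D) `|u x| = \sum_(i < n) \int[mu]_(x in `]a i, b i[) `|u x|.
  rewrite /Rintegral /D integral_bigsetU_EFin//=.
  - rewrite -sum_fine// => i _; apply: integral_fune_fin_num; first exact: measurable_itv.
    by apply: iE; exact: measurable_itv.
  - exact: index_enum_uniq.
  - by apply: sub_trivIset tab.
  - by have /integrableP[] := iE _ mD.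
apply: ler_sum => i _.
rewrite Rintegral_itvB ?bnd_simp//; last exact: integrableS iu.
rewrite [leRHS]Rintegral_itv_bndo_bndc; last by apply: iE; exact: measurable_itv.
by apply: le_normr_Rintegral; [exact: measurable_itv|exact: integrableS iu].
Qed.

(** By Lebesgue differentiation, the indefinite integral of [u] extended by 0 has the same
    derivative as [f] almost everywhere on [0, 1]; the difference is absolutely continuous with zero
    derivative, hence constant. *)
Theorem ac01_ftc (f u : R -> R) : absolutely_continuous01 f ->
  mu.-integrable `[0, 1] (EFin \o u) ->
  {ae mu, forall t : R, 0 <= t <= 1 -> is_derive t 1 f (u t)} ->
  forall t : R, 0 <= t <= 1 -> f t - f 0 = \int[mu]_(s in `[0, t]) u s.
Proof.
move=> acf iu df t /andP[t0 t1].
pose v := u \_ `[0, 1].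
have iv : mu.-integrable setT (EFin \o v).
  by rewrite /v -restrict_EFin -integrable_mkcond.
pose F x := \int[mu]_(s in `]-oo, x]) v s.
have dF : {ae mu, forall x, derivable F x 1 /\ derive1 F x = v x}.
  apply: FTC1Ny; first by move=> y; exact: integrableS iv.
  exact: integrable_locally.
have : {ae mu, forall t : R, 0 <= t <= 1 -> is_derive t 1 (f \- F) 0}.
  apply: (@filterS2 _ _ (ae_filter_ringOfSetsType mu) _ _ _ _ df dF) => s dfs [dFs Fs] s01.
  rewrite (_ : 0 = u s - v s); last by rewrite /v patchE mem_set ?subrr//= in_itv.
  apply: is_deriveB; first exact: dfs.
  by apply: DeriveDef; [exact: dFs|rewrite -Fs derive1E].
have acfF : absolutely_continuous01 (f \- F).
  apply: (ac01_le (C := 1) _ acf (ac01_integral iv)) => // a b _ _ _.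
  rewrite mul1r /= -/(F a) -/(F b) (_ : f b - F b - (f a - F a) = (f b - f a) - (F b - F a)).
    exact: ler_normB.
  by rewrite !opprB; lra.
move=> /(ac01_derive0 acfF) /(_ t); rewrite t0 t1 => /(_ isT)/= h.
have -> : f t - f 0 = F t - F 0 by lra.
rewrite /F Rintegral_itvB ?bnd_simp//; last exact: integrableS iv.
rewrite Rintegral_itv_obnd_cbnd; last exact: integrableS iv.
apply: eq_Rintegral => s; rewrite inE/= in_itv/= => /andP[s0 st].
by rewrite /v patchE mem_set//= in_itv/= s0 (le_trans st).
Qed.
End absolute_continuity.

(** * Horizontal curves *)

Section heisenberg_curves.
Variable R : realType.
Notation mu := (@lebesgue_measure R).
Implicit Types (c : R -> heis R) (g h q : heis R) (u v : R -> R).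

Lemma is_deriveE (V : normedModType R) (f : R -> V) (t : R) (df : V) :
  is_derive t 1 f df <-> h^-1 *: (f (h + t) - f t) @[h --> 0^'] --> df.
Proof.
have E : (fun h : R => h^-1 *: (f (h *: (1 : R) + t) - f t)) =
    (fun h : R => h^-1 *: (f (h + t) - f t)).
  by apply/funext => h; rewrite /GRing.scale/= mulr1.
split=> [[dft <-]|cf].
  by move: dft; rewrite /derivable /derive/= E.
have dft : derivable f t 1.
  by apply/cvg_ex; exists df; rewrite /= E.
apply: DeriveDef => //; rewrite /derive /= E.
exact: cvg_lim.
Qed.

Lemma is_derive_pair (V W : normedModType R) (f : R -> V) (g : R -> W) (t : R) df dg :
  is_derive t 1 (fun s => (f s, g s)) (df, dg) <->
  is_derive t 1 f df /\ is_derive t 1 g dg.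
Proof.
rewrite !is_deriveE; split=> [cfg|[cf cg]].
  split.
    exact: (cvg_comp _ _ cfg (@cvg_fst _ _ (nbhs df) (nbhs dg) _)).
  exact: (cvg_comp _ _ cfg (@cvg_snd _ _ (nbhs df) (nbhs dg) _)).
exact: (cvg_pair cf cg).
Qed.

Definition hx (q : heis R) : R := q.1.1.
Definition hy (q : heis R) : R := q.1.2.
Definition hz (q : heis R) : R := q.2.

Lemma hx_mul g h : hx (heis_mul g h) = hx g + hx h.
Proof. by case: g => [[? ?] ?]; case: h => [[? ?] ?]. Qed.

Lemma hy_mul g h : hy (heis_mul g h) = hy g + hy h.
Proof. by case: g => [[? ?] ?]; case: h => [[? ?] ?]. Qed.

Lemma hz_mul g h :
  hz (heis_mul g h) = hz g + hz h + 2^-1 * (hx g * hy h - hx h * hy g).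
Proof. by case: g => [[? ?] ?]; case: h => [[? ?] ?]. Qed.

Lemma heis_eq g h : hx g = hx h -> hy g = hy h -> hz g = hz h -> g = h.
Proof.
by case: g => [[? ?] ?]; case: h => [[? ?] ?]; rewrite /hx /hy /hz /= => -> -> ->.
Qed.

Lemma heis_normE q : `|q| = Num.max (Num.max `|hx q| `|hy q|) `|hz q|.
Proof. by rewrite !prod_normE. Qed.

(** The norm of [heis R] is the maximum of the coordinates, so horizontality splits into three
    scalar equations, the form in which [ac01_ftc] applies. *)
Lemma horizontalP c u v : horizontal c u v <->
  [/\ [/\ absolutely_continuous01 (hx \o c), absolutely_continuous01 (hy \o c)
        & absolutely_continuous01 (hz \o c)],
      measurable_fun (`[0, 1]%classic : set R) u,
      measurable_fun (`[0, 1]%classic : set R) v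
    & {ae mu, forall t : R, 0 <= t <= 1 ->
        [/\ is_derive t 1 (hx \o c) (u t), is_derive t 1 (hy \o c) (v t) &
            is_derive t 1 (hz \o c) (2^-1 * (hx (c t) * v t - hy (c t) * u t))]}].
Proof.
have cE : c = fun s => (hx (c s), hy (c s), hz (c s)).
  by apply/funext => s; rewrite /hx /hy /hz; case: (c s) => [[]].
have dE (t : R) : is_derive t 1 c (u t *: heisX (c t) + v t *: heisY (c t)) <->
    [/\ is_derive t 1 (hx \o c) (u t), is_derive t 1 (hy \o c) (v t) &
        is_derive t 1 (hz \o c) (2^-1 * (hx (c t) * v t - hy (c t) * u t))].
  rewrite [X in is_derive t 1 X _]cE.
  rewrite [X in is_derive t 1 _ X](_ : _ =
    (u t, v t, 2^-1 * (hx (c t) * v t - hy (c t) * u t))); last first.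
    congr (_, _, _); rewrite /= /GRing.scale /=.
    - by rewrite mulr1 mulr0 addr0.
    - by rewrite mulr1 mulr0 add0r.
    - by rewrite /hx /hy; ring.
  rewrite !is_derive_pair.
  by split=> [[[]]|[]].
split=> [[ac mu_ mv dc]|[[acx acy acz] mu_ mv dc]].
  split=> //.
    by split; apply: (ac01_le (C := 1) _ ac ac) => // a b _ _ _;
      rewrite mul1r (@le_trans _ _ `|c b - c a|) ?lerDl// heis_normE !le_max lexx ?orbT.
  by apply: (@filterS _ _ (ae_filter_ringOfSetsType mu) _ _ _ dc) => t /[swap] t01 /(_ t01)/dE.
split=> //; last first.
  by apply: (@filterS _ _ (ae_filter_ringOfSetsType mu) _ _ _ dc) => t /[swap] t01 /(_ t01)/dE.
have acxy : absolutely_continuous01 (fun s => (hx (c s), hy (c s))).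
  apply: (ac01_le (C := 1) _ acx acy) => // a b _ _ _.
  by rewrite mul1r prod_normE/= ge_max lerDl lerDr !normr_ge0.
rewrite cE; apply: (ac01_le (C := 1) _ acxy acz) => // a b _ _ _.
by rewrite mul1r prod_normE/= ge_max lerDl lerDr !normr_ge0.
Qed.

Lemma ac01_lincomb (f g h : R -> R) (a b c e : R) :
  absolutely_continuous01 f -> absolutely_continuous01 g ->
  absolutely_continuous01 h ->
  absolutely_continuous01 (fun s => e + (a * f s + b * g s + c * h s)).
Proof.
move=> acf acg ach.
have le2 (a' b' x y : R) : `|a' * x + b' * y| <= (`|a'| + `|b'|) * (`|x| + `|y|).
  rewrite (le_trans (ler_normD _ _))// !normrM mulrDl !mulrDr.
  by rewrite -addrA lerD2l addrA lerDr addr_ge0// mulr_ge0.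
have acfg : absolutely_continuous01 (fun s => a * f s + b * g s).
  apply: (ac01_le (C := `|a| + `|b|) _ acf acg) => [|s t _ _ _]; first by rewrite addr_ge0.
  rewrite (_ : _ - _ = a * (f t - f s) + b * (g t - g s)) ?le2//.
  by ring.
apply: (ac01_le (C := `|1| + `|c|) _ acfg ach) => [|s t _ _ _]; first by rewrite addr_ge0.
rewrite (_ : _ - _ = 1 * (a * f t + b * g t - (a * f s + b * g s)) + c * (h t - h s)) ?le2//.
by ring.
Qed.

Lemma is_derive_lincomb (f g h : R -> R) (a b c e t df dg dh : R) :
  is_derive t 1 f df -> is_derive t 1 g dg -> is_derive t 1 h dh ->
  is_derive t 1 (fun s => e + (a * f s + b * g s + c * h s))
    (a * df + b * dg + c * dh).
Proof.
move=> hf hg hh.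
have := is_deriveD (is_derive_cst e t 1)
  (is_deriveD (is_deriveD (is_deriveZ a hf) (is_deriveZ b hg)) (is_deriveZ c hh)).
by move/is_derive_eq; apply; rewrite add0r.
Qed.

(** A linear map of the plane, acting on the centre by its determinant: this is what makes it a
    group endomorphism ([heis_lin_mul]) that preserves horizontal curves. *)
Definition heis_lin (a b c d : R) q : heis R :=
  (a * hx q + b * hy q, c * hx q + d * hy q, (a * d - b * c) * hz q).

Lemma hx_lin (a b c d : R) q : hx (heis_lin a b c d q) = a * hx q + b * hy q.
Proof. by []. Qed.

Lemma hy_lin (a b c d : R) q : hy (heis_lin a b c d q) = c * hx q + d * hy q.
Proof. by []. Qed.

Lemma hz_lin (a b c d : R) q : hz (heis_lin a b c d q) = (a * d - b * c) * hz q.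
Proof. by []. Qed.

Lemma horizontal_affine (k : heis R) (a b c d : R) f u v : horizontal f u v ->
  horizontal (fun t => heis_mul k (heis_lin a b c d (f t)))
    (fun t => a * u t + b * v t) (fun t => c * u t + d * v t).
Proof.
rewrite !horizontalP => -[[acx acy acz] mu_ mv df].
set g := fun t => heis_mul _ _.
have hxE : hx \o g = fun s => hx k + (a * (hx \o f) s + b * (hy \o f) s + 0 * (hz \o f) s).
  by apply/funext => s; rewrite /g /= hx_mul mul0r addr0.
have hyE : hy \o g = fun s => hy k + (c * (hx \o f) s + d * (hy \o f) s + 0 * (hz \o f) s).
  by apply/funext => s; rewrite /g /= hy_mul mul0r addr0.
have hzE : hz \o g = fun s => hz k +
    (2^-1 * (hx k * c - hy k * a) * (hx \o f) s +
     2^-1 * (hx k * d - hy k * b) * (hy \o f) s + (a * d - b * c) * (hz \o f) s).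
  by apply/funext => s; rewrite /g /= hz_mul hx_lin hy_lin hz_lin; ring.
split.
- by split; rewrite ?hxE ?hyE ?hzE; exact: ac01_lincomb.
- by apply: measurable_funD; exact: measurable_funM.
- by apply: measurable_funD; exact: measurable_funM.
- apply: (@filterS _ _ (ae_filter_ringOfSetsType mu) _ _ _ df) => t /[swap] t01 /(_ t01)[dx dy dz].
  split.
  + by rewrite hxE; have /is_derive_eq := is_derive_lincomb a b 0 (hx k) dx dy dz; apply; ring.
  + by rewrite hyE; have /is_derive_eq := is_derive_lincomb c d 0 (hy k) dx dy dz; apply; ring.
  + rewrite hzE; have /is_derive_eq := is_derive_lincomb
     (2^-1 * (hx k * c - hy k * a)) (2^-1 * (hx k * d - hy k * b)) (a * d - b * c) (hz k)
       dx dy dz; apply.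
    by rewrite hx_mul hy_mul hx_lin hy_lin /=; ring.
Qed.

End heisenberg_curves.
Arguments hx {R} q.
Arguments hy {R} q.
Arguments hz {R} q.
Arguments heis_lin {R} a b c d q.

(** * Lower bounds for the length of a curve issued from the origin *)

Section curve_lower_bounds.
Variable R : realType.

Lemma lerN_norm (a : R) : - a <= `|a|.
Proof. by rewrite -normrN ler_norm. Qed.

Notation mu := (@lebesgue_measure R).

(** Freezing [f] outside [0, 1] keeps it continuous; the extension provides the extrema and the
    measurability of the first coordinate of a curve. *)
Lemma ac01_extension (f : R -> R) : absolutely_continuous01 f ->
  exists2 g : R -> R, continuous g & forall t, 0 <= t <= 1 -> g t = f t.
Proof.
move=> acf; pose clamp (t : R) := if t <= 0 then 0 else if 1 <= t then 1 else t.
have c01 t : 0 <= clamp t <= 1.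
  by rewrite /clamp; case: (leP t 0) => ?; [|case: (leP 1 t) => ?]; apply/andP; split; lra.
have cid t : 0 <= t <= 1 -> clamp t = t.
  by move=> /andP[? ?]; rewrite /clamp; case: (leP t 0) => ?; [|case: (leP 1 t) => ?]; lra.
have clip s t : s <= t -> clamp s <= clamp t <= clamp s + (t - s).
  by rewrite /clamp => ?; case: (leP t 0) => ?; case: (leP s 0) => ?;
    case: (leP 1 t) => ?; case: (leP 1 s) => ?; apply/andP; split; lra.
exists (f \o clamp) => [t|t /cid /= -> //].
apply/cvgrPdist_lt => e e0.
have [d d0 acd] := acf _ e0.
have close a b : 0 <= a -> a <= b -> b <= 1 -> b - a < d -> `|f b - f a| < e.
  move=> a0 ab b1 bad.
  have := acd 1 (fun=> a) (fun=> b); rewrite !big_ord1; apply => //.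
  by move=> i j _ _ _; rewrite [i]ord1 [j]ord1.
apply/nbhs_ballP; exists d => //= s; rewrite /ball/= => st.
have [/andP[s0 s1] /andP[t0 t1]] := (c01 s, c01 t).
have [ts|ts] := leP s t.
  have /andP[h1 h2] := clip _ _ ts; apply: close => //.
  by rewrite ger0_norm ?subr_ge0// in st; lra.
have /andP[h1 h2] := clip _ _ (ltW ts); rewrite distrC; apply: close => //.
by rewrite ltr0_norm ?subr_lt0// in st; lra.
Qed.

(** The two intermediate times are meant to be those of the extrema of [F]; with [t2 = 1] the
    inequality bounds [F t1 - F 0] by the variation. *)
Lemma integral_variation (F u : R -> R) (t1 t2 : R) :
  0 <= t1 -> t1 <= t2 -> t2 <= 1 ->
  mu.-integrable `[0, 1] (EFin \o u) ->
  (forall t, 0 <= t <= 1 -> F t - F 0 = \int[mu]_(s in `[0, t]) u s) ->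
  `|F t1 - F 0| + `|F t2 - F t1| + `|F 1 - F t2|
    <= \int[mu]_(s in `[0, 1]) `|u s|.
Proof.
move=> t10 t12 t21 iu FE.
have inu : mu.-integrable `[0, 1] (EFin \o (Num.norm \o u)) by exact: integrable_norm.
pose G t := \int[mu]_(s in `[0, t]) (Num.norm \o u) s.
have sub (a b : R) b0 b1 : 0 <= a -> b <= 1 ->
    [set` Interval (BSide b0 a) (BSide b1 b)] `<=` `[0, 1].
  move=> a0 b1' s /=; rewrite !in_itv/=.
  by case: b0; case: b1 => /= /andP[h1 h2]; apply/andP; split; lra.
have FG a b : 0 <= a -> a <= b -> b <= 1 -> `|F b - F a| <= G b - G a.
  move=> a0 ab b1; have -> : F b - F a = (F b - F 0) - (F a - F 0) by ring.
  rewrite !FE ?a0 ?b1 ?(le_trans a0)// ?(le_trans _ b1)//.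
  rewrite /G !Rintegral_itvB ?bnd_simp//.
  - by apply: le_normr_Rintegral => //; apply: integrableS iu => //; exact: sub.
  - by apply: integrableS inu => //; exact: sub.
  - by apply: integrableS iu => //; exact: sub.
have G0 : G 0 = 0 by rewrite /G set_itv1 Rintegral_set1.
have := FG 0 t1; have := FG t1 t2; have := FG t2 1.
rewrite G0 subr0 => /(_ (le_trans t10 t12) t21 (lexx _)) h1 /(_ t10 t12 t21) h2.
move=> /(_ (lexx _) t10 (le_trans t12 t21)) h3.
by rewrite -[leRHS]/(G 1); lra.
Qed.

(* With [w = z + x y / 2] one has [w' = x y'], so [w] measures the signed area
   swept by the projected curve against the vertical axis. *)
Lemma curve_estimates (c : R -> heis R) (u v : R -> R) (L : R) :
  horizontal c u v -> c 0 = (0, 0, 0) ->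
  curve_length Exponent1 u v = L%:E ->
  let X := hx (c 1) in let Y := hy (c 1) in let W := hz (c 1) + 2^-1 * (X * Y) in
  exists V1 V2 M m : R, [/\ L = V1 + V2, `|X| <= V1, `|Y| <= V2, `|W| <= V1 * V2 &
    [/\ m <= 0, 0 <= M, 2 * (M - m) <= V1 + `|X| &
        W <= (M + m) / 2 * Y + (M - m) / 2 * V2]].
Proof.
move=> /horizontalP[[acx acy acz] mu_ mv dc] c0 cL X Y W.
pose x := hx \o c; pose y := hy \o c; pose z := hz \o c.
have m01 : measurable (`[0, 1]%classic : set R) by exact: measurable_itv.
have iuv : mu.-integrable `[0, 1] (EFin \o (fun t => `|u t| + `|v t|)).
  apply/integrableP; split.
    by apply/measurable_EFinP; apply: measurable_funD; exact: measurableT_comp.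
  under eq_integral do rewrite /= ger0_norm ?addr_ge0//.
  by move: cL; rewrite /curve_length /norm_p => ->; rewrite ltry.
have iu : mu.-integrable `[0, 1] (EFin \o u).
  apply: le_integrable iuv => //; first exact/measurable_EFinP.
  by move=> t _ /=; rewrite lee_fin [leRHS]ger0_norm ?addr_ge0// lerDl.
have iv : mu.-integrable `[0, 1] (EFin \o v).
  apply: le_integrable iuv => //; first exact/measurable_EFinP.
  by move=> t _ /=; rewrite lee_fin [leRHS]ger0_norm ?addr_ge0// lerDr.
have inu : mu.-integrable `[0, 1] (EFin \o (fun t => `|u t|)) by exact: integrable_norm iu.
have inv : mu.-integrable `[0, 1] (EFin \o (fun t => `|v t|)) by exact: integrable_norm iv.
have iZ (k : R) (f : R -> R) : mu.-integrable `[0, 1] (EFin \o f) ->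
    mu.-integrable `[0, 1] (EFin \o (fun t => k * f t)).
  by move=> iff; have := @integrableZl _ _ R mu _ _ k _ iff; apply; exact: measurable_itv.
pose V1 := \int[mu]_(s in `[0, 1]) `|u s|.
pose V2 := \int[mu]_(s in `[0, 1]) `|v s|.
have LE : L = V1 + V2.
  have := cL; rewrite /curve_length /norm_p => /(congr1 fine) /= <-.
  by rewrite -RintegralD.
have ae_sub (f g : R -> R) : (forall t : R, 0 <= t <= 1 ->
   [/\ is_derive t 1 (hx \o c) (u t), is_derive t 1 (hy \o c) (v t) &
            is_derive t 1 (hz \o c) (2^-1 * (hx (c t) * v t - hy (c t) * u t))] ->
              is_derive t 1 f (g t)) ->
   {ae mu, forall t : R, 0 <= t <= 1 -> is_derive t 1 f (g t)}.
  move=> H; apply: (@filterS _ _ (ae_filter_ringOfSetsType mu) _ _ _ dc) => t h t01.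
  exact: H (h t01).
have xE := ac01_ftc acx iu (ae_sub _ _ (fun t _ '(And3 h _ _) => h)).
have yE := ac01_ftc acy iv (ae_sub _ _ (fun t _ '(And3 _ h _) => h)).
have x0 : x 0 = 0 by rewrite /x /= c0.
have y0 : y 0 = 0 by rewrite /y /= c0.
have xV t : 0 <= t <= 1 -> `|x t| <= V1.
  move=> /andP[t0 t1]; have := integral_variation t0 t1 (lexx _) iu xE.
  by rewrite -!/(x _) x0 subr0 subrr normr0 addr0 -/V1; have := normr_ge0 (x 1 - x t); lra.
have yV t : 0 <= t <= 1 -> `|y t| <= V2.
  move=> /andP[t0 t1]; have := integral_variation t0 t1 (lexx _) iv yE.
  by rewrite -!/(y _) y0 subr0 subrr normr0 addr0 -/V2; have := normr_ge0 (y 1 - y t); lra.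
have [xx cxx xxE] := ac01_extension acx.
have cxx' : {within `[0, 1], continuous xx} by exact: continuous_subspaceT.
have [tM tM01 xM] := EVT_max ler01 cxx'.
have [tm tm01 xm] := EVT_min ler01 cxx'.
rewrite !in_itv/= in tM01 tm01.
pose M := x tM; pose m := x tm.
have xMm t : 0 <= t <= 1 -> m <= x t <= M.
  move=> t01; have := xM t; have := xm t; rewrite !in_itv/= !xxE// => /(_ t01) -> /(_ t01) ->.
  by [].
have mx : measurable_fun (`[0, 1]%classic : set R) x.
  apply: eq_measurable_fun (measurable_funTS (continuous_measurable_fun cxx)) => t.
  by rewrite inE/= in_itv/= => /xxE.
have ixv : mu.-integrable `[0, 1] (EFin \o (fun t => x t * v t)).
  have := iZ V1 _ inv.
  apply: le_integrable => //; first by apply/measurable_EFinP; exact: measurable_funM.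
  move=> t /=; rewrite in_itv/= => t01; rewrite lee_fin !normrM normr_id ler_wpM2r//.
  exact: le_trans (xV _ t01) (ler_norm _).
have acw : absolutely_continuous01 (fun t => z t + 2^-1 * (x t * y t)).
  have acxy : absolutely_continuous01 (fun t => x t * y t).
    apply: (ac01_le (C := V1 + V2) _ acx acy).
      by rewrite addr_ge0// ?(le_trans _ (xV 0 _)) ?(le_trans _ (yV 0 _))// lexx ler01.
    move=> a b a0 ab b1.
    have -> : x b * y b - x a * y a = x b * (y b - y a) + (x b - x a) * y a by ring.
    have [xb ya] : `|x b| <= V1 /\ `|y a| <= V2.
      by split; [apply: xV; rewrite (le_trans a0 ab)|apply: yV; rewrite a0 (le_trans ab b1)].
    have [V10 V20] := (le_trans (normr_ge0 _) xb, le_trans (normr_ge0 _) ya).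
    rewrite (le_trans (ler_normD _ _))// !normrM -/x -/y.
    set dx := `|x b - x a|; set dy := `|y b - y a|.
    rewrite [leRHS](_ : _ = V1 * dy + V2 * dx + (V1 * dx + V2 * dy)); last by ring.
    rewrite ler_wpDr ?addr_ge0 ?mulr_ge0 ?normr_ge0//.
    by rewrite lerD// ?[dx * _]mulrC ler_wpM2r ?normr_ge0.
  rewrite (_ : (fun _ => _) = fun t => 0 + (1 * z t + 2^-1 * (x t * y t) + 0 * (x t * y t))).
    exact: ac01_lincomb.
  by apply/funext => t; rewrite add0r mul1r mul0r addr0.
have wE : W = \int[mu]_(s in `[0, 1]) (x s * v s).
  rewrite -(ac01_ftc acw ixv) ?lexx ?ler01//; last first.
    apply: ae_sub => t _ [dx dy dz].
    have := is_derive_lincomb 1 2^-1 0 0 dz (is_deriveM dx dy) dz.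
    rewrite (_ : (fun _ => _) = (fun t => z t + 2^-1 * (x t * y t))); last first.
      by apply/funext => s; rewrite add0r mul1r mul0r addr0.
    move=> /is_derive_eq; apply; rewrite /GRing.scale/= /x /y /=; by field.
  by rewrite x0 mul0r mulr0 addr0 /z /= c0 subr0.
have YE : Y = \int[mu]_(s in `[0, 1]) v s.
  by rewrite -yE ?lexx ?ler01//= c0 subr0.
exists V1, V2, M, m; split=> //.
- by have := xV 1; rewrite lexx ler01; apply.
- by have := yV 1; rewrite lexx ler01; apply.
- rewrite wE (le_trans (le_normr_Rintegral _ _))// -RintegralZl//.
  apply: le_Rintegral => //; first exact: integrable_norm ixv.
    exact: iZ inv.
  by move=> t; rewrite /= in_itv/= => t01; rewrite normrM ler_wpM2r// xV.
split.
- by have := xMm 0; rewrite x0 lexx ler01 => /(_ isT)/andP[].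
- by have := xMm 0; rewrite x0 lexx ler01 => /(_ isT)/andP[].
(* The path goes from 0 to one extremum, to the other, then to [X]: [V1] is at least 2 (M - m) + X
   or 2 (M - m) - X, according to which comes first. *)
- have [/andP[tM0 tM1] /andP[tm0 tm1]] := (tM01, tm01).
  have h1 := ler_norm X; have h2 := lerN_norm X.
  have [tMm|tMm] := leP tM tm.
    have := integral_variation tM0 tMm tm1 iu xE; rewrite -!/(x _) x0 subr0 -/M -/m -/V1 -[x 1]/X.
    have := ler_norm M; have := lerN_norm (m - M); have := ler_norm (X - m).
    by move=> *; lra.
  have := integral_variation tm0 (ltW tMm) tM1 iu xE;
    rewrite -!/(x _) x0 subr0 -/M -/m -/V1 -[x 1]/X.
  have := lerN_norm m; have := ler_norm (M - m); have := lerN_norm (X - M).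
  by move=> *; lra.
(* Pointwise, x stays within (M - m) / 2 of the midpoint (M + m) / 2, so x v <= (M + m) / 2 v + (M -
   m) / 2 |v|. *)
- rewrite wE YE -!RintegralZl// -RintegralD//.
  + apply: le_Rintegral => //.
    * exact: integrableD (iZ _ _ iv) (iZ _ _ inv).
    * move=> t; rewrite /= in_itv/= => /xMm/andP[h1 h2].
      have := ler_norm (v t); have := lerN_norm (v t); move=> *; nra.
  + exact: iZ iv.
  + exact: iZ inv.
Qed.
End curve_lower_bounds.

(** * Concatenation of curves *)

Section gluing.
Variable R : realType.
Notation mu := (@lebesgue_measure R).

Definition glue (T : Type) (l : R) (f g : R -> T) (t : R) : T :=
  if t <= l then f (t / l) else g ((t - l) / (1 - l)).

Lemma glue_lipschitz (l C : R) (f g : R -> R) : 0 < l -> l < 1 -> f 1 = g 0 ->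
  (forall a b : R, 0 <= a -> a <= b -> b <= 1 -> `|f b - f a| <= C * (b - a)) ->
  (forall a b : R, 0 <= a -> a <= b -> b <= 1 -> `|g b - g a| <= C * (b - a)) ->
  forall a b : R, 0 <= a -> a <= b -> b <= 1 ->
  `|glue l f g b - glue l f g a| <= (C / l + C / (1 - l)) * (b - a).
Proof.
move=> l0 l1 fg lf lg.
have l1' : 0 < 1 - l by rewrite subr_gt0.
have C0 : 0 <= C.
  by have := lf _ _ (lexx 0) ler01 (lexx _); rewrite subr0 mulr1; apply: le_trans.
have H1 a b : 0 <= a -> a <= b -> b <= l ->
    `|f (b / l) - f (a / l)| <= C / l * (b - a).
  move=> a0 ab bl; rewrite mulrAC -mulrA mulrBl; apply: lf.
  - by rewrite divr_ge0// ltW.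
  - by rewrite ler_pM2r ?invr_gt0.
  - by rewrite ler_pdivrMr// mul1r.
have H2 a b : l <= a -> a <= b -> b <= 1 ->
    `|g ((b - l) / (1 - l)) - g ((a - l) / (1 - l))| <= C / (1 - l) * (b - a).
  move=> la ab b1.
  rewrite (_ : C / (1 - l) * (b - a) = C * ((b - l) / (1 - l) - (a - l) / (1 - l))).
    apply: lg.
    - by rewrite divr_ge0 ?subr_ge0// ltW.
    - by rewrite ler_pM2r ?invr_gt0// lerD2r.
    - by rewrite ler_pdivrMr// mul1r lerD2r.
  by field; rewrite gt_eqF.
have Cl : 0 <= C / l by rewrite divr_ge0// ltW.
have Cl' : 0 <= C / (1 - l) by rewrite divr_ge0// ltW.
move=> a b a0 ab b1; rewrite /glue; case: (leP b l) => bl.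
  rewrite (le_trans ab bl) (le_trans (H1 _ _ a0 ab bl))//.
  by rewrite ler_wpM2r ?subr_ge0// lerDl.
case: (leP a l) => al; last first.
  rewrite (le_trans (H2 _ _ (ltW al) ab b1))//.
  by rewrite ler_wpM2r ?subr_ge0// lerDr.
have h1 := H1 _ _ a0 al (lexx _); have h2 := H2 _ _ (lexx _) (ltW bl) b1.
rewrite divff ?gt_eqF// in h1; rewrite subrr mul0r in h2.
rewrite (_ : _ - _ = (g ((b - l) / (1 - l)) - g 0) + (f 1 - f (a / l))); last by rewrite fg; ring.
rewrite (le_trans (ler_normD _ _))// (le_trans (lerD h2 h1))//.
by rewrite addrC mulrDl; apply: lerD; apply: ler_wpM2l => //;
  [rewrite lerD2r ltW|rewrite lerD2l lerN2].
Qed.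

Lemma is_derive_affine (f : R -> R) (a b t d : R) :
  is_derive (a * t + b) 1 f d -> is_derive t 1 (fun s => f (a * s + b)) (a * d).
Proof.
move=> df.
have da : is_derive t 1 (fun s : R => a * s + b) a.
  have := is_deriveD (is_deriveZ a (is_derive_id t (1 : R))) (is_derive_cst b t 1).
  by move=> /is_derive_eq; apply; rewrite addr0 /GRing.scale/= mulr1.
have := @is_derive1_comp _ f (fun s : R => a * s + b) t _ _ df da.
by move=> /is_derive_eq; apply; rewrite mulrC.
Qed.

Lemma glue_derive_left (l t d : R) (f g : R -> R) : 0 < l -> t < l ->
  is_derive (t / l) 1 f d -> is_derive t 1 (glue l f g) (d / l).
Proof.
move=> l0 tl df.
have df' : is_derive t 1 (fun s => f (l^-1 * s + 0)) (l^-1 * d).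
  by apply: is_derive_affine; rewrite addr0 mulrC.
rewrite mulrC; apply: near_eq_is_derive df'.
have : \forall s \near t, s < l by exact: lt_nbhsl.
by apply: filterS => s sl; rewrite /glue ltW// addr0 mulrC.
Qed.

Lemma glue_derive_right (l t d : R) (f g : R -> R) : l < 1 -> l < t ->
  is_derive ((t - l) / (1 - l)) 1 g d ->
  is_derive t 1 (glue l f g) (d / (1 - l)).
Proof.
move=> l1 lt_ dg.
have E s : (s - l) / (1 - l) = (1 - l)^-1 * s + (- l / (1 - l)).
  by rewrite mulrBl [s / _]mulrC mulNr.
have dg' : is_derive t 1 (fun s => g ((1 - l)^-1 * s + (- l / (1 - l)))) ((1 - l)^-1 * d).
  by apply: is_derive_affine; rewrite -E.
rewrite mulrC; apply: near_eq_is_derive dg'.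
have : \forall s \near t, l < s by exact: lt_nbhsr.
by apply: filterS => s ls; rewrite /glue leNgt ls/= E.
Qed.

Lemma measurable_glue (l : R) (f g : R -> R) : measurable_fun setT f ->
  measurable_fun setT g -> measurable_fun setT (glue l f g).
Proof.
move=> mf mg; apply: measurable_fun_ifT.
- by apply: measurable_fun_ler.
- by apply: (measurableT_comp mf); exact: mulrr_measurable.
- apply: (measurableT_comp mg); apply: measurable_funM => //.
  exact: measurable_funB.
Qed.

(* [L] bounds the speed, so that the length of [c] is at most [L]; the bound is
   not required to be sharp, which leaves room for constant pieces. *)
Definition joined (g h : heis R) (L : R) : Prop :=
  0 < L /\ exists (c : R -> heis R) (u v : R -> R) (C : R) (D : set R),
  [/\ c 0 = g /\ c 1 = h,
      forall a b : R, 0 <= a -> a <= b -> b <= 1 ->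
        [/\ `|hx (c b) - hx (c a)| <= C * (b - a),
            `|hy (c b) - hy (c a)| <= C * (b - a) &
            `|hz (c b) - hz (c a)| <= C * (b - a)],
      measurable_fun setT u, measurable_fun setT v &
      finite_set D /\ forall t : R, 0 <= t <= 1 -> ~ D t ->
        [/\ `|u t| + `|v t| <= L, is_derive t 1 (hx \o c) (u t),
            is_derive t 1 (hy \o c) (v t) &
            is_derive t 1 (hz \o c) (2^-1 * (hx (c t) * v t - hy (c t) * u t))]].

Lemma joined_line (g : heis R) (a b L : R) : 0 < L -> `|a| + `|b| <= L ->
  joined g (heis_mul g (a, b, 0)) L.
Proof.
move=> L0 abL; split=> //.
pose m := 2^-1 * (hx g * b - hy g * a).
exists (fun t => (hx g + a * t, hy g + b * t, hz g + m * t)), (cst a), (cst b),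
  (`|a| + `|b| + `|m|), set0.
have lip (e p C : R) s t : `|p| <= C -> s <= t ->
    `|(e + p * t) - (e + p * s)| <= C * (t - s).
  move=> pC st; rewrite (_ : _ - _ = p * (t - s)); last by ring.
  by rewrite normrM ler_pM// ger0_norm ?subr_ge0.
have der (e p t : R) : is_derive t 1 (fun s => e + p * s) p.
  have := is_deriveD (is_derive_cst e t 1) (is_deriveZ p (is_derive_id t (1 : R))).
  by move=> /is_derive_eq; apply; rewrite add0r /GRing.scale/= mulr1.
split=> //.
- split.
    by rewrite /hx /hy /hz !mulr0 !addr0; case: g {m} => [[]].
  apply: heis_eq; rewrite ?hx_mul ?hy_mul ?hz_mul /hx /hy /hz /= ?mulr1//.
  by rewrite addr0 /m /hx /hy [a * _]mulrC.
- move=> s t s0 st t1; split; apply: lip => //.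
  + by rewrite -addrA lerDl addr_ge0.
  + by rewrite addrAC lerDr addr_ge0.
  + by rewrite lerDr addr_ge0.
- split; first exact: finite_set0.
  move=> t _ _; split=> //; [exact: der|exact: der|].
  rewrite (_ : _ * _ = m); first exact: der.
  by rewrite /m /hx /hy /=; ring.
Qed.

Lemma joined_trans (g h k : heis R) (L1 L2 : R) :
  joined g h L1 -> joined h k L2 -> joined g k (L1 + L2).
Proof.
move=> [L10 [c1 [u1 [v1 [C1 [D1 [[c10 c11] lip1 mu1 mv1 [fD1 H1]]]]]]]].
move=> [L20 [c2 [u2 [v2 [C2 [D2 [[c20 c21] lip2 mu2 mv2 [fD2 H2]]]]]]]].
have L0 : 0 < L1 + L2 by rewrite addr_gt0.
(* The breakpoint is proportional to the speed bounds, so that after rescaling both pieces have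
   speed at most [L1 + L2]. *)
split=> //; pose l := L1 / (L1 + L2).
have l0 : 0 < l by rewrite divr_gt0.
have l1 : l < 1 by rewrite ltr_pdivrMr// mul1r ltrDl.
have l1E : 1 - l = L2 / (L1 + L2) by rewrite /l; field; rewrite gt_eqF.
have l1' : 0 < 1 - l by rewrite subr_gt0.
have glueE (T : Type) (p : heis R -> T) : p \o glue l c1 c2 = glue l (p \o c1) (p \o c2).
  by apply/funext => t; rewrite /glue/=; case: ifP.
exists (glue l c1 c2), (fun t => glue l u1 u2 t * glue l (cst l^-1) (cst (1 - l)^-1) t).
exists (fun t => glue l v1 v2 t * glue l (cst l^-1) (cst (1 - l)^-1) t).
pose C := Num.max C1 C2.
exists (C / l + C / (1 - l)).
exists ([set 0; l; 1] `|` ( *%R l @` D1 `|` (fun s => l + (1 - l) * s) @` D2)).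
split.
- split; rewrite /glue.
    by rewrite ltW// mul0r.
  by rewrite leNgt l1/= divff ?gt_eqF.
- have CE a b : a <= b -> C1 * (b - a) <= C * (b - a) /\ C2 * (b - a) <= C * (b - a).
    by move=> ab; rewrite !ler_wpM2r ?subr_ge0// /C le_max lexx ?orbT.
  move=> a b a0 ab b1.
  rewrite -!/((_ \o glue l c1 c2) _) !glueE.
  split; apply: glue_lipschitz => //=; rewrite ?c11 ?c20// => s t s0 st t1.
  + by have [lp _ _] := lip1 s t s0 st t1; apply: le_trans lp _; have [] := CE s t st.
  + by have [lp _ _] := lip2 s t s0 st t1; apply: le_trans lp _; have [] := CE s t st.
  + by have [_ lp _] := lip1 s t s0 st t1; apply: le_trans lp _; have [] := CE s t st.
  + by have [_ lp _] := lip2 s t s0 st t1; apply: le_trans lp _; have [] := CE s t st.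
  + by have [_ _ lp] := lip1 s t s0 st t1; apply: le_trans lp _; have [] := CE s t st.
  + by have [_ _ lp] := lip2 s t s0 st t1; apply: le_trans lp _; have [] := CE s t st.
- by apply: measurable_funM; apply: measurable_glue.
- by apply: measurable_funM; apply: measurable_glue.
split.
  rewrite !finite_setU; repeat split => //; exact: finite_image.
move=> t /andP[t0 t1] nD.
have [tl|lt_|tl] := ltgtP t l; last by exfalso; apply: nD; left; left; right.
- have t01 : 0 <= t / l <= 1 by rewrite divr_ge0 ?(ltW l0)//= ler_pdivrMr// mul1r ltW.
  have [|s dx dy dz] := H1 _ t01.
    move=> D1t; apply: nD; right; left; exists (t / l) => //.
    by rewrite mulrCA divff ?mulr1// gt_eqF.
  have cE : glue l c1 c2 t = c1 (t / l) by rewrite /glue ltW.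
  rewrite !glueE !cE.
  have E (p q : R -> R) : glue l p q t * glue l (cst l^-1) (cst (1 - l)^-1) t = p (t / l) / l.
    by rewrite /glue ltW.
  rewrite !E.
  split; try exact: glue_derive_left.
  + rewrite !normrM -mulrDl [`|l^-1|]gtr0_norm ?invr_gt0// ler_pdivrMr//.
    by rewrite (le_trans s)// /l mulrC divfK ?gt_eqF.
  + have -> : 2^-1 * (hx (c1 (t / l)) * (v1 (t / l) / l) - hy (c1 (t / l)) * (u1 (t / l) / l)) =
      2^-1 * (hx (c1 (t / l)) * v1 (t / l) - hy (c1 (t / l)) * u1 (t / l)) / l by ring.
    exact: glue_derive_left.
- have t01 : 0 <= (t - l) / (1 - l) <= 1.
    by rewrite divr_ge0 ?subr_ge0 ?(ltW l1) ?(ltW lt_)//= ler_pdivrMr// mul1r lerD2r.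
  have [|s dx dy dz] := H2 _ t01.
    move=> D1t; apply: nD; right; right; exists ((t - l) / (1 - l)) => //.
    by field; rewrite gt_eqF.
  have cE : glue l c1 c2 t = c2 ((t - l) / (1 - l)) by rewrite /glue leNgt lt_.
  rewrite !glueE !cE.
  have E (p q : R -> R) : glue l p q t * glue l (cst l^-1) (cst (1 - l)^-1) t =
      q ((t - l) / (1 - l)) / (1 - l).
    by rewrite /glue leNgt lt_.
  rewrite !E.
  set s' := (t - l) / (1 - l) in t01 s dx dy dz cE *.
  split; try exact: glue_derive_right.
  + rewrite !normrM -mulrDl [`|(1 - l)^-1|]gtr0_norm ?invr_gt0// ler_pdivrMr//.
    by rewrite (le_trans s)// l1E mulrC divfK ?gt_eqF.
  + have -> : 2^-1 * (hx (c2 s') * (v2 s' / (1 - l)) - hy (c2 s') * (u2 s' / (1 - l))) =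
      2^-1 * (hx (c2 s') * v2 s' - hy (c2 s') * u2 s') / (1 - l) by ring.
    exact: glue_derive_right.
Qed.

Lemma joined_curve (g h : heis R) (L : R) : joined g h L ->
  exists (c : R -> heis R) (u v : R -> R) (l : R), [/\ horizontal c u v, c 0 = g, c 1 = h,
    curve_length Exponent1 u v = l%:E & l <= L].
Proof.
move=> [L0 [c [u [v [C [D [[c0 c1] lip mu_ mv [fD H]]]]]]]].
have m01 : measurable (`[0, 1]%classic : set R) by exact: measurable_itv.
have nD : mu.-negligible D.
  exists D; split=> //; last by apply: countable_lebesgue_measure0; exact: finite_set_countable.
  by apply: countable_measurable; [move=> t; exact: measurable_set1|exact: finite_set_countable].
have hor : horizontal c u v.
  rewrite horizontalP; split.
  - by split; apply: (ac01_lipschitz (C := C)) => a b a0 ab b1; have [] := lip a b a0 ab b1.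
  - exact: measurable_funTS.
  - exact: measurable_funTS.
  - apply: negligibleS nD => t /= nt; apply: contrapT => Dt; apply: nt => t01.
    by have [] := H t t01 Dt.
have lenL : (curve_length Exponent1 u v <= L%:E)%E.
  rewrite -[leRHS]mule1 -[X in (_ * X)%E](_ : mu `[0, 1]%classic = 1%E); last first.
    by rewrite lebesgue_measure_itv/= lte_fin ltr01 oppr0 adde0.
  rewrite -integral_cst//; apply: ae_ge0_le_integral => //.
  - by move=> t _; rewrite lee_fin addr_ge0.
  - apply/measurable_EFinP/measurable_funTS.
    by apply: measurable_funD; exact: measurableT_comp.
  - by move=> t _; rewrite lee_fin ltW.
  - apply: negligibleS nD => t /= nt; apply: contrapT => Dt; apply: nt => t01.
    by rewrite lee_fin; have [] := H t t01 Dt.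
have len0 : (0 <= curve_length Exponent1 u v)%E.
  by apply: integral_ge0 => t _; rewrite lee_fin addr_ge0.
exists c, u, v, (fine (curve_length Exponent1 u v)); split=> //.
  by rewrite fineK// ge0_fin_numE// (le_lt_trans lenL)// ltry.
by rewrite -lee_fin fineK// ge0_fin_numE// (le_lt_trans lenL)// ltry.
Qed.

End gluing.

(** * The distance *)

Section distance.
Variable R : realType.
Notation mu := (@lebesgue_measure R).
Implicit Types (g h k q : heis R) (p : exponent1oo).

Definition heis0 : heis R := (0, 0, 0).
Definition heis_inv g : heis R := (- hx g, - hy g, - hz g).

Lemma hx_inv g : hx (heis_inv g) = - hx g. Proof. by []. Qed.
Lemma hy_inv g : hy (heis_inv g) = - hy g. Proof. by []. Qed.
Lemma hz_inv g : hz (heis_inv g) = - hz g. Proof. by []. Qed.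

Lemma hx0 : hx heis0 = 0. Proof. by []. Qed.
Lemma hy0 : hy heis0 = 0. Proof. by []. Qed.
Lemma hz0 : hz heis0 = 0. Proof. by []. Qed.

Definition heisE := (hx0, hy0, hz0, hx_mul, hy_mul, hz_mul, hx_lin, hy_lin, hz_lin,
  hx_inv, hy_inv, hz_inv).

Lemma heis_mulKV g h : heis_mul g (heis_mul (heis_inv g) h) = h.
Proof. by apply: heis_eq; rewrite !heisE; ring. Qed.

Lemma heis_mulVK g h : heis_mul (heis_inv g) (heis_mul g h) = h.
Proof. by apply: heis_eq; rewrite !heisE; ring. Qed.

Lemma heis_mulVg g : heis_mul (heis_inv g) g = heis0.
Proof. by apply: heis_eq; rewrite !heisE; ring. Qed.

Lemma heis_lin_mul (a b c d : R) g h :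
  heis_lin a b c d (heis_mul g h) = heis_mul (heis_lin a b c d g) (heis_lin a b c d h).
Proof. by apply: heis_eq; rewrite !heisE; ring. Qed.

(* Isometry from the [p]-distance to the [1]-distance:
   [max |u| |v| = |(u + v) / 2| + |(u - v) / 2|]. *)
Definition to_l1 p q : heis R :=
  match p with
  | Exponent1 => heis_lin 1 0 0 1 q
  | Exponentoo => heis_lin 2^-1 2^-1 2^-1 (- 2^-1) q
  end.

Definition of_l1 p q : heis R :=
  match p with
  | Exponent1 => heis_lin 1 0 0 1 q
  | Exponentoo => heis_lin 1 1 1 (- 1) q
  end.

Lemma to_l1K p : cancel (to_l1 p) (of_l1 p).
Proof. by move=> q; case: p; apply: heis_eq; rewrite !heisE; field. Qed.

Lemma of_l1K p : cancel (of_l1 p) (to_l1 p).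
Proof. by move=> q; case: p; apply: heis_eq; rewrite !heisE; field. Qed.

Lemma to_l1M p g h : to_l1 p (heis_mul g h) = heis_mul (to_l1 p g) (to_l1 p h).
Proof. by case: p; exact: heis_lin_mul. Qed.

Lemma norm_to_l1 (a b : R) : norm_p Exponent1 (2^-1 * a + 2^-1 * b) (2^-1 * a + - 2^-1 * b) =
  norm_p Exponentoo a b.
Proof.
rewrite /norm_p -!mulrDr mulNr -mulrBr !normrM (ger0_norm (_ : 0 <= 2^-1))//.
case: (ger0P (a + b)) => h1; case: (ger0P (a - b)) => h2;
  case: (ger0P a) => h3; case: (ger0P b) => h4; case: leP => h5; lra.
Qed.

Lemma norm_of_l1 (a b : R) : norm_p Exponentoo (1 * a + 1 * b) (1 * a + - 1 * b) =
  norm_p Exponent1 a b.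
Proof.
by rewrite -norm_to_l1; congr (norm_p _ _ _); field.
Qed.

Definition lengths p g h : set (\bar R) :=
  [set l | exists (c : R -> heis R) (u v : R -> R),
     [/\ horizontal c u v, c 0 = g, c 1 = h & l = curve_length p u v]].

(** Translating to the origin and changing the control by [to_l1] are invertible and preserve
    lengths. The whole sets of lengths agree, so [heis_dist] transfers directly through [ereal_inf]
    and [fine]. *)
Lemma lengths_l1 p g h :
  lengths p g h = lengths Exponent1 heis0 (to_l1 p (heis_mul (heis_inv g) h)).
Proof.
apply/seteqP; split=> l [c [u [v [hor c0 c1 ->]]]].
- pose k := to_l1 p (heis_inv g).
  case: p @k => k.
  + exists (fun t => heis_mul k (heis_lin 1 0 0 1 (c t))), (fun t => 1 * u t + 0 * v t),
    (fun t => 0 * u t + 1 * v t).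
    split; first exact: horizontal_affine.
    * by rewrite c0 /k -to_l1M heis_mulVg; apply: heis_eq; rewrite !heisE; ring.
    * by rewrite c1 /k -to_l1M.
    * by apply: eq_integral => t _; rewrite !mul0r !mul1r addr0 add0r.
  + exists (fun t => heis_mul k (heis_lin 2^-1 2^-1 2^-1 (- 2^-1) (c t))).
    exists (fun t => 2^-1 * u t + 2^-1 * v t), (fun t => 2^-1 * u t + - 2^-1 * v t).
    split; first exact: horizontal_affine.
    * by rewrite c0 /k -to_l1M heis_mulVg; apply: heis_eq; rewrite !heisE; ring.
    * by rewrite c1 /k -to_l1M.
    * by apply: eq_integral => t _; rewrite norm_to_l1.
- case: p c1 => c1.
  + exists (fun t => heis_mul g (heis_lin 1 0 0 1 (c t))), (fun t => 1 * u t + 0 * v t),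
    (fun t => 0 * u t + 1 * v t).
    split; first exact: horizontal_affine.
    * by rewrite c0; apply: heis_eq; rewrite !heisE; ring.
    * by rewrite c1; apply: heis_eq; rewrite !heisE; ring.
    * by apply: eq_integral => t _; rewrite !mul0r !mul1r addr0 add0r.
  + exists (fun t => heis_mul g (heis_lin 1 1 1 (- 1) (c t))).
    exists (fun t => 1 * u t + 1 * v t), (fun t => 1 * u t + - 1 * v t).
    split; first exact: horizontal_affine.
    * by rewrite c0; apply: heis_eq; rewrite !heisE; ring.
    * by rewrite c1; apply: heis_eq; rewrite !heisE; field.
    * by apply: eq_integral => t _; rewrite norm_of_l1.
Qed.

Definition l1_norm q : R := heis_dist Exponent1 heis0 q.

Lemma heis_distE p g h :
  heis_dist p g h = l1_norm (to_l1 p (heis_mul (heis_inv g) h)).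
Proof.
by rewrite /l1_norm /heis_dist -!/(lengths _ _ _) lengths_l1.
Qed.

(* [reach g h L]: [g] and [h] are joined by curves of length at most [L + e],
   for every [e > 0]. *)
Definition reach g h (L : R) : Prop := forall e, 0 < e -> joined g h (L + e).

Lemma reach_line g (a b : R) : reach g (heis_mul g (a, b, 0)) (`|a| + `|b|).
Proof.
by move=> e e0; apply: joined_line; rewrite ?lerDl ?ltW// ltr_wpDl// addr_ge0.
Qed.

Lemma reach_trans g h k (L1 L2 : R) :
  reach g h L1 -> reach h k L2 -> reach g k (L1 + L2).
Proof.
move=> gh hk e e0; have e20 : 0 < e / 2 by rewrite divr_gt0.
rewrite (_ : _ + e = (L1 + e / 2) + (L2 + e / 2)); last by field.
exact: joined_trans (gh _ e20) (hk _ e20).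
Qed.

Lemma reach_le g h (L1 L2 : R) : L1 <= L2 -> reach g h L1 -> reach g h L2.
Proof.
move=> L12 r e e0; have -> : L2 + e = L1 + (L2 - L1 + e) by ring.
by apply: r; rewrite ltr_wpDl// subr_ge0.
Qed.

Lemma curve_length_ge0 p (u v : R -> R) : (0 <= curve_length p u v)%E.
Proof.
apply: integral_ge0 => t _; rewrite lee_fin.
by case: p => /=; rewrite ?addr_ge0// le_max normr_ge0.
Qed.

Lemma l1_norm_reach q L : reach heis0 q L -> l1_norm q <= L.
Proof.
move=> r; apply/ler_addgt0Pl => e e0; rewrite addrC.
have [c [u [v [l [hor c0 c1 lenc lL]]]]] := joined_curve (r e e0).
apply: le_trans lL; rewrite -lee_fin.
have inf0 : (0 <= ereal_inf (lengths Exponent1 heis0 q))%E.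
  by apply: le_ereal_inf_tmp => _ [? [? [? [_ _ _ ->]]]]; exact: curve_length_ge0.
have infl : (ereal_inf (lengths Exponent1 heis0 q) <= l%:E)%E.
  by apply: ereal_inf_lbound; exists c, u, v.
rewrite /l1_norm /heis_dist -/(lengths _ _ _) fineK//.
by rewrite ge0_fin_numE// (le_lt_trans infl)// ltry.
Qed.

(** Go along x by [a], along y by [y], then along x by [x - a]. The first coordinate is [a] while
    the second varies, so the end has z + x y / 2 = a y, which dictates [a]. *)
Lemma reach_swept (x y z : R) : y != 0 ->
  let a := x / 2 + z / y in
  reach heis0 (x, y, z) (`|a| + `|x - a| + `|y|).
Proof.
move=> y0 a.
have r1 := @reach_line heis0 a 0.
have r2 := @reach_line (heis_mul heis0 (a, 0, 0)) 0 y.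
have r3 := @reach_line (heis_mul (heis_mul heis0 (a, 0, 0)) (0, y, 0)) (x - a) 0.
have := reach_trans (reach_trans r1 r2) r3.
rewrite !normr0 addr0 add0r addr0 -addrA [`|y| + _]addrC addrA.
rewrite (_ : heis_mul _ _ = (x, y, z))//.
by apply: heis_eq; rewrite !heisE /hx /hy /hz /= ?/a; field.
Qed.

(** The bound on [z] places the abscissa [a] of [reach_swept] between 0 and [x]: the staircase is
    then monotone and has length |x| + |y|. *)
Lemma l1_norm_monotone (x y z : R) : `|z| <= 2^-1 * `|x * y| ->
  l1_norm (x, y, z) <= `|x| + `|y|.
Proof.
move=> zxy; apply: l1_norm_reach.
have [y0|y0] := eqVneq y 0.
  move: zxy; rewrite y0 mulr0 normr0 mulr0 normr_le0 => /eqP ->.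
  have := @reach_line heis0 x 0; rewrite normr0.
  by rewrite (_ : heis_mul _ _ = (x, 0, 0))//; apply: heis_eq; rewrite !heisE /hx /hy /hz /=; ring.
rewrite (_ : `|x| = `|x / 2 + z / y| + `|x - (x / 2 + z / y)|); first exact: reach_swept.
have : `|z / y| <= 2^-1 * `|x|.
  by rewrite normrM normfV ler_pdivrMr ?normr_gt0// -mulrA -normrM.
set s := z / y => sx.
move: sx; case: (ger0P x) => h1; rewrite ler_norml => /andP[h2 h3].
  by rewrite !ger0_norm; lra.
by rewrite !ler0_norm; lra.
Qed.

(** Here [a] of [reach_swept] is at least [x]: the path overshoots and comes back, with length a + y
    + (a - x). *)
Lemma l1_norm_le_wedge (x y z : R) : 0 < y -> 0 <= x / 2 + z / y -> x / 2 <= z / y ->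
  l1_norm (x, y, z) <= y + 2 * z / y.
Proof.
move=> y0 a0 xa; apply: l1_norm_reach.
rewrite (_ : _ + _ = `|x / 2 + z / y| + `|x - (x / 2 + z / y)| + `|y|).
  by apply: reach_swept; rewrite gt_eqF.
by rewrite ger0_norm// ler0_norm ?gtr0_norm//; [field; rewrite gt_eqF|lra].
Qed.

(* After the two sides leading to [(x, y, x y / 2)], a rectangular loop of signed
   area [z - x y / 2]. *)
Lemma reach_norm (x y z : R) : reach heis0 (x, y, z)
  (`|x| + `|y| + 4 * Num.sqrt `|z - 2^-1 * (x * y)|).
Proof.
set w := z - _; set s := Num.sqrt `|w|; pose t := Num.sg w * s.
have s0 : 0 <= s by exact: sqrtr_ge0.
have ts : `|t| <= s.
  by rewrite /t normrM normr_sg (ger0_norm s0); case: (w != 0); rewrite ?mul1r// mul0r.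
have st : s * t = w.
  rewrite /t mulrCA -expr2 sqr_sqrtr//.
  by rewrite -numEsg.
have r1 := @reach_line heis0 x 0.
have r2 := @reach_line (heis_mul heis0 (x, 0, 0)) 0 y.
pose g := heis_mul (heis_mul heis0 (x, 0, 0)) (0, y, 0).
have r3 := @reach_line g s 0.
have r4 := @reach_line (heis_mul g (s, 0, 0)) 0 t.
have r5 := @reach_line (heis_mul (heis_mul g (s, 0, 0)) (0, t, 0)) (- s) 0.
have r6 := @reach_line (heis_mul (heis_mul (heis_mul g (s, 0, 0)) (0, t, 0)) (- s, 0, 0)) 0 (- t).
have := reach_trans (reach_trans (reach_trans (reach_trans (reach_trans r1 r2) r3) r4) r5) r6.
rewrite (_ : heis_mul _ (0, - t, 0) = (x, y, z)); last first.
  have -> : z = w + 2^-1 * (x * y) by rewrite /w; ring.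
  by rewrite -st; apply: heis_eq; rewrite /g !heisE /hx /hy /hz /=; field.
apply: reach_le; rewrite !normrN !normr0 (ger0_norm s0).
by move: ts; set T := `|t|; move=> *; lra.
Qed.

Lemma l1_norm_le (x y z : R) : l1_norm (x, y, z) <=
  `|x| + `|y| + 4 * Num.sqrt `|z - 2^-1 * (x * y)|.
Proof. exact: l1_norm_reach (@reach_norm x y z). Qed.

Lemma l1_norm_ge0 q : 0 <= l1_norm q.
Proof.
apply: fine_ge0; apply: le_ereal_inf_tmp => _ [? [? [? [_ _ _ ->]]]].
exact: curve_length_ge0.
Qed.

Lemma heis_dist_ge0 p g h : 0 <= heis_dist p g h.
Proof. by rewrite heis_distE l1_norm_ge0. Qed.

(** The lower bounds on [l1_norm] follow by applying [curve_estimates] to these curves and letting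
    [e] tend to 0. The infimum is finite by [reach_norm]. *)
Lemma l1_norm_approx q (e : R) : 0 < e ->
  exists (c : R -> heis R) (u v : R -> R) (L : R),
  [/\ horizontal c u v, c 0 = heis0, c 1 = q,
    curve_length Exponent1 u v = L%:E & L < l1_norm q + e].
Proof.
move=> e0.
have inf0 : (0 <= ereal_inf (lengths Exponent1 heis0 q))%E.
  by apply: le_ereal_inf_tmp => _ [? [? [? [_ _ _ ->]]]]; exact: curve_length_ge0.
have fin : ereal_inf (lengths Exponent1 heis0 q) \is a fin_num.
  have [c [u [v [l [hor c0 c1 lenc _]]]]] := joined_curve (@reach_norm (hx q) (hy q) (hz
    q) 1 ltr01).
  rewrite ge0_fin_numE//; apply: (@le_lt_trans _ _ l%:E); last by rewrite ltry.
  by apply: ereal_inf_lbound; exists c, u, v; split=> //; rewrite c1; exact: heis_eq.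
have [_ [c [u [v [hor c0 c1 ->]]]] lt_] := lb_ereal_inf_adherent e0 fin.
have lenf : curve_length Exponent1 u v \is a fin_num.
  by rewrite ge0_fin_numE ?curve_length_ge0// (lt_trans lt_)// -(fineK fin) -EFinD ltry.
exists c, u, v, (fine (curve_length Exponent1 u v)); split=> //; first by rewrite fineK.
by rewrite -lte_fin fineK// EFinD /l1_norm /heis_dist -/(lengths _ _ _) fineK.
Qed.

Lemma l1_norm_ge q : `|hx q| + `|hy q| <= l1_norm q.
Proof.
apply/ler_addgt0Pl => e /(l1_norm_approx q)[c [u [v [L [hor c0 c1 lenc lt_]]]]].
have := curve_estimates hor c0 lenc; rewrite c1.
move=> [V1 [V2 [M [m [LE hX hY _ _]]]]]; lra.
Qed.

(** In |W| <= V1 V2, use V1 <= L and V2 = L - V1 <= L - |x|. Keeping the second factor, rather than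
    a plain square, is essential: it is the excess that [geodesic_initial_segment] forces to
    vanish. *)
Lemma l1_norm_swept q : `|hz q + 2^-1 * (hx q * hy q)| <=
  l1_norm q * (l1_norm q - `|hx q|).
Proof.
have n0 := l1_norm_ge0 q; set n := l1_norm q in n0 *.
have xn : `|hx q| <= n.
  by apply: le_trans (l1_norm_ge q); rewrite lerDl.
apply/ler_addgt0Pl => e e0.
(* For [d <= 1], replacing n by n + d in both factors of n (n - |x|) adds at most d (2 n + 1). *)
have d0 : 0 < Num.min 1 (e / (2 * n + 1)).
  by rewrite lt_min ltr01 divr_gt0// ltr_wpDl// mulr_ge0.
have [c [u [v [L [hor c0 c1 lenc]]]]] := l1_norm_approx q d0.
set d := Num.min _ _ in d0 *; rewrite -/n => lt_.
have [d1 d2] : d <= 1 /\ d * (2 * n + 1) <= e.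
  split; first by rewrite /d ge_min lexx.
  by rewrite -ler_pdivlMr ?ltr_wpDl ?mulr_ge0// /d ge_min lexx orbT.
have := curve_estimates hor c0 lenc; rewrite c1.
move=> [V1 [V2 [M [m [LE hX hY hW _]]]]].
apply: (le_trans hW).
have V10 : 0 <= V1 by exact: le_trans hX.
have V20 : 0 <= V2 by exact: le_trans hY.
have h1 : V1 <= n + d by lra.
have h2 : V2 <= n + d - `|hx q| by lra.
apply: (@le_trans _ _ ((n + d) * (n + d - `|hx q|))); first by rewrite ler_pM.
have := normr_ge0 (hx q); nra.
Qed.

(** Put w = M - m and n = (V2 - y) / 2, and let a = x / 2 + z / y. As m <= 0, the area bound gives a
    y <= w (y + n), whence a <= w + n because a <= y. Then V1 + V2 >= (2 w - x) + (y + 2 n) >= y + 2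
    a - x, the length of the path of [l1_norm_le_wedge]. *)
Lemma l1_norm_ge_wedge (x y z : R) : 0 <= x -> 0 < y -> 0 <= x / 2 + z / y <= y ->
  y + 2 * z / y <= l1_norm (x, y, z).
Proof.
move=> x0 y0 /andP[a0 ay].
apply/ler_addgt0Pl => e /(l1_norm_approx (x, y, z))[c [u [v [L [hor c0 c1 lenc lt_]]]]].
have := curve_estimates hor c0 lenc; rewrite c1 /hx /hy /hz /=.
move=> [V1 [V2 [M [m [LE hX hY _ [m0 M0 hM hW]]]]]].
pose a := x / 2 + z / y.
have zE : z + 2^-1 * (x * y) = a * y by rewrite /a; field; rewrite gt_eqF.
have -> : 2 * z / y = 2 * a - x by rewrite /a; field; rewrite gt_eqF.
rewrite zE in hW; rewrite -/a in a0 ay.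
rewrite gtr0_norm// in hY; rewrite ger0_norm// in hX hM.
have : a <= (M - m) + (V2 - y) / 2.
  pose n := (V2 - y) / 2; pose w := M - m.
  have n0 : 0 <= n by rewrite divr_ge0// subr_ge0.
  have : a * y <= w * (y + n).
    apply: (le_trans hW); rewrite /w /n; nra.
  rewrite -/n -/w => h.
  have yn : 0 < y + n by rewrite ltr_wpDr.
  rewrite -(ler_pM2r yn); nra.
by lra.
Qed.

Lemma l1_norm_hz q : `|hz q| <= 2 * l1_norm q ^+ 2.
Proof.
have h1 := l1_norm_ge q; have h2 := l1_norm_swept q; have h0 := l1_norm_ge0 q.
have hx0' := normr_ge0 (hx q); have hy0' := normr_ge0 (hy q).
have -> : hz q = (hz q + 2^-1 * (hx q * hy q)) - 2^-1 * (hx q * hy q) by ring.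
rewrite (le_trans (ler_normB _ _))// [`|2^-1 * _|]normrM [`|hx q * hy q|]normrM
  (ger0_norm (_ : 0 <= 2^-1))//.
set n := l1_norm q in h1 h2 h0 *; nra.
Qed.

End distance.

(** * Geodesics *)

Section geodesics_of_heisenberg.
Variable R : realType.
Implicit Types (g h k q : heis R) (p : exponent1oo).

Lemma hz_mulVl g h : hz (heis_mul (heis_inv g) h) =
  hz h - hz g - 2^-1 * (hx g * hy h - hx h * hy g).
Proof. by rewrite !heisE; ring. Qed.

(** With [heis_dist_coord_le], this is the ball-box comparison: balls of radius r are comparable to
    left translates of boxes of sides r, r, r^2. The factor 4 is 2 from [l1_norm_hz] times 2, the
    inverse of the scaling of z by [to_l1] for the oo-norm. *)
Lemma heis_dist_coord_ge p g h :
  [/\ `|hx h - hx g| <= heis_dist p g h, `|hy h - hy g| <= heis_dist p g h &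
      `|hz h - hz g - 2^-1 * (hx g * hy h - hx h * hy g)|
        <= 4 * heis_dist p g h ^+ 2].
Proof.
rewrite -hz_mulVl ![_ h - _]addrC -hx_inv -hy_inv -hx_mul -hy_mul heis_distE.
move: (heis_mul _ _) => q.
have := l1_norm_ge (to_l1 p q); have := l1_norm_hz (to_l1 p q).
have := l1_norm_ge0 (to_l1 p q).
case: p; rewrite /to_l1 !heisE; set n := l1_norm _ => n0.
  rewrite !mul1r !mul0r addr0 add0r subr0 mul1r => h1 h2.
  have := normr_ge0 (hx q); have := normr_ge0 (hy q); have := sqr_ge0 n.
  by move=> *; split; lra.
have -> : (2^-1 * - 2^-1 - 2^-1 * 2^-1) * hz q = - (2^-1 * hz q) by field.
rewrite normrN normrM (ger0_norm (_ : 0 <= 2^-1))// => h1 h2.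
have xE : hx q = (2^-1 * hx q + 2^-1 * hy q) + (2^-1 * hx q + - 2^-1 * hy q) by field.
have yE : hy q = (2^-1 * hx q + 2^-1 * hy q) - (2^-1 * hx q + - 2^-1 * hy q) by field.
split; last by lra.
  by apply: le_trans h2; rewrite {1}xE ler_normD.
by apply: le_trans h2; rewrite {1}yE ler_normB.
Qed.

Lemma heis_dist_coord_le p g h (r : R) : 0 <= r ->
  `|hx h - hx g| <= r -> `|hy h - hy g| <= r ->
  `|hz h - hz g - 2^-1 * (hx g * hy h - hx h * hy g)| <= r ^+ 2 ->
  heis_dist p g h <= 10 * r.
Proof.
move=> r0; rewrite -hz_mulVl ![_ h - _]addrC -hx_inv -hy_inv -hx_mul -hy_mul heis_distE.
move: (heis_mul _ _) => q hxr hyr hzr.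
have H (x y z : R) : `|x| <= r -> `|y| <= r -> `|z| <= r ^+ 2 -> l1_norm (x, y, z) <= 10 * r.
  move=> xr yr zr; apply: (le_trans (l1_norm_le x y z)).
  (* r^2 + r^2 / 2 <= (2 r)^2; with the factor 4 of [l1_norm_le] the total is r + r + 8 r. *)
  have : Num.sqrt `|z - 2^-1 * (x * y)| <= 2 * r.
    have r20 : 0 <= 2 * r by rewrite mulr_ge0.
    rewrite -[leRHS](ger0_norm r20) -[leRHS]sqrtr_sqr; apply: ler_wsqrtr.
    rewrite (le_trans (ler_normB _ _))//.
    have : `|2^-1 * (x * y)| <= 2^-1 * r ^+ 2.
      by rewrite !normrM (ger0_norm (_ : 0 <= 2^-1))// ler_pM2l// expr2 ler_pM.
    by rewrite exprMn; have := sqr_ge0 r; move=> *; lra.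
  by move=> *; lra.
case: p; rewrite /to_l1 /heis_lin; apply: H.
- by rewrite mul1r mul0r addr0.
- by rewrite mul1r mul0r add0r.
- by rewrite mul1r mul0r subr0 mul1r.
- rewrite (le_trans (ler_normD _ _))// !normrM (ger0_norm (_ : 0 <= 2^-1))//; lra.
- rewrite (le_trans (ler_normD _ _))// !normrM normrN (ger0_norm (_ : 0 <= 2^-1))//; lra.
- have -> : (2^-1 * - 2^-1 - 2^-1 * 2^-1) * hz q = - (2^-1 * hz q) by field.
  by rewrite normrN normrM (ger0_norm (_ : 0 <= 2^-1))//; have := normr_ge0 (hz q); lra.
Qed.

Lemma heis_dist_eq0 p g h : heis_dist p g h = 0 -> g = h.
Proof.
move=> d0; have [] := heis_dist_coord_ge p g h; rewrite d0 expr0n/= mulr0 !normr_le0.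
move=> /eqP x0 /eqP y0 /eqP z0.
have xE : hx g = hx h by lra.
have yE : hy g = hy h by lra.
by apply: heis_eq => //; move: z0; rewrite xE yE; lra.
Qed.

(* All minimising geodesics from the origin to the region below start along the
   [x]-axis. *)
Lemma geodesic_initial_segment (s x y z X Y Z : R) : 0 < s ->
  s <= X <= 2 * s -> 9 * s <= Y <= 10 * s -> 10 * s ^+ 2 <= Z <= 20 * s ^+ 2 ->
  l1_norm (x, y, z) <= 100^-1 * s ->
  l1_norm (x, y, z) + l1_norm (heis_mul (heis_inv (x, y, z)) (X, Y, Z))
    <= l1_norm (X, Y, Z) ->
  z = 0.
Proof.
move=> s0 /andP[X1 X2] /andP[Y1 Y2] /andP[Z1 Z2].
have -> : heis_mul (heis_inv (x, y, z)) (X, Y, Z) = (X - x, Y - y, Z - z - 2^-1 * (x * Y - X * y)).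
  by apply: heis_eq; rewrite !heisE /hx /hy /hz /=; ring.
have := l1_norm_ge (x, y, z); have := l1_norm_swept (x, y, z).
have := l1_norm_hz (x, y, z).
have := l1_norm_ge0 (x, y, z); rewrite /hx /hy /hz /=; set r := l1_norm (x, y, z).
set X' := X - x; set Y' := Y - y; set Z' := Z - _ - _ => r0 zr wr xyr rs.
have Y0 : 0 < Y by lra.
have xr := ler_norm x; have yr := ler_norm y.
have xr' := lerN_norm x; have yr' := lerN_norm y.
have x0 := normr_ge0 x; have y0 := normr_ge0 y.
pose b := Z / Y.
have ZE : Z = b * Y by rewrite /b divfK// gt_eqF.
have b1 : s <= b by rewrite /b ler_pdivlMr//; nra.
have b2 : b <= 20 / 9 * s by rewrite /b ler_pdivrMr//; nra.
have hP : l1_norm (X, Y, Z) <= Y + 2 * b.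
  rewrite /b mulrA; apply: l1_norm_le_wedge => //; rewrite -/b; lra.
have X'0 : 0 <= X' by rewrite /X'; lra.
have Y'0 : 0 < Y' by rewrite /Y'; lra.
have zs : `|z| <= 2 * (100^-1 * s) ^+ 2.
  apply: (le_trans zr); rewrite ler_pM2l// lerXn2r// nnegrE//; lra.
pose b' := Z' / Y'.
have Z'E : Z' = b' * Y' by rewrite /b' divfK// gt_eqF.
have z1 := ler_norm z; have z2 := lerN_norm z.
have xY : `|x * Y| <= 10^-1 * s ^+ 2 by rewrite normrM (gtr0_norm Y0); nra.
have Xy : `|X * y| <= 50^-1 * s ^+ 2 by rewrite normrM (ger0_norm (_ : 0 <= X)); [nra|lra].
(* The region has enough margin for the remaining displacement to satisfy the hypothesis 0 <= X' / 2
   + b' <= Y' of [l1_norm_ge_wedge]. *)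
have hb' : 0 <= b' <= Y' - X' / 2.
  rewrite /b' divr_ge0 ?(ltW Y'0)//=.
    rewrite ler_pdivrMr// /Z'.
    have := ler_norm (X * y); have := lerN_norm (x * Y); rewrite /X' /Y'; nra.
  rewrite /Z'.
  have := lerN_norm (X * y); have := ler_norm (x * Y); nra.
have hP' : Y' + 2 * b' <= l1_norm (X', Y', Z').
  rewrite /b' mulrA; apply: l1_norm_ge_wedge => //; rewrite -/b'; lra.
move=> le_; have {hP hP' le_} le_ : r + (Y' + 2 * b') <= Y + 2 * b by lra.
pose w := z + 2^-1 * (x * y).
pose V := r - `|x|.
have V0 : 0 <= V by rewrite /V; lra.
have yV : `|y| <= V by rewrite /V; lra.
(* The length inequality multiplied by [Y'], rewritten with the excess [V] and the swept area [w]: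
   the left side is of first order in [V] and [y]. *)
have key : V * Y' + y * (2 * (b + X / 2) - Y') <= 2 * w.
  have e1 : (r - y - 2 * b) * Y' + 2 * (b' * Y') <= 0.
    rewrite (_ : _ + _ = (r - y + 2 * b' - 2 * b) * Y'); last by ring.
    by rewrite mulr_le0_ge0 ?(ltW Y'0)//; move: le_; rewrite /Y'; lra.
  have e2 : x * Y' <= `|x| * Y' by rewrite ler_wpM2r// ltW.
  move: e1 e2; rewrite -Z'E /Z' ZE /w /V /Y'; clear; move=> *; lra.
have yw : - (y * (2 * (b + X / 2) - Y')) <= `|y| * (Y' - s).
  rewrite -mulrN (le_trans (ler_norm _))// normrM ler_wpM2l//.
  by rewrite ler_norml; apply/andP; split; rewrite /Y'; lra.
(* In the region |2 b + X - Y'| <= Y' - s, and |y| <= V, so at least [s * V] is left of the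
   first-order term, against an area [w] of at most [r * V]. As 100 r <= s, [V] vanishes. *)
have : s * V <= 2 * (r * V).
  have e3 : `|y| * (Y' - s) <= V * (Y' - s) by rewrite ler_wpM2r// /Y'; lra.
  have e4 : w <= r * V by exact: le_trans (ler_norm w) wr.
  by move: key yw e3 e4; clear; move=> *; lra.
move=> sV; have VV : V = 0.
  have e3 : 100 * (r * V) <= s * V by rewrite mulrA ler_wpM2r//; lra.
  have : s * V <= 0 by lra.
  by rewrite pmulr_rle0// => ?; apply/eqP; rewrite eq_le V0 andbT.
have : `|w| <= 0 by rewrite -(mulr0 r) -VV; exact: wr.
have : `|y| <= 0 by rewrite -VV.
by rewrite !normr_le0 /w => /eqP -> ; rewrite !mulr0 addr0 => /eqP.
Qed.

(* The monotone path of [1]-speed [1] running along the [x]-axis by [a], then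
   parallel to the [y]-axis by [b], then parallel to the [x]-axis for ever. *)
Definition stair_x (a b t : R) : R := Num.min t a + Num.max 0 (t - a - b).
Definition stair_y (a b t : R) : R := Num.min (Num.max (t - a) 0) b.
Definition stair (a b t : R) : heis R :=
  (stair_x a b t, stair_y a b t,
   2^-1 * (stair_y a b t * (2 * a - stair_x a b t))).

(** The last clause expresses that the second coordinate moves only while the first equals [a]; it
    controls the height between two points of the staircase. *)
Lemma stair_le (a b s t : R) : 0 <= a -> 0 <= b -> 0 <= s -> s <= t ->
  [/\ stair_x a b s <= stair_x a b t, stair_y a b s <= stair_y a b t,
      stair_x a b t - stair_x a b s + (stair_y a b t - stair_y a b s) = t - s &
      stair_y a b t = stair_y a b s \/ stair_x a b s <= a <= stair_x a b t].
Proof.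
move=> a0 b0 s0 st; rewrite /stair_x /stair_y.
have E u : 0 <= u -> [\/ [/\ u <= a, Num.min u a + Num.max 0 (u - a - b) = u & Num.min
  (Num.max (u - a) 0) b = 0],
   [/\ a <= u <= a + b, Num.min u a + Num.max 0 (u - a - b) = a & Num.min (Num.max (u -
     a) 0) b = u - a] |
   [/\ a + b <= u, Num.min u a + Num.max 0 (u - a - b) = u - b & Num.min (Num.max (u - a)
     0) b = b] ].
  move=> u0; have [ua|au] := leP u a.
    constructor 1; rewrite max_l ?max_r; [|lra|lra].
    by rewrite min_l// addr0.
  have [uab|abu] := leP u (a + b).
    constructor 2; rewrite max_l ?max_l; [|lra|lra].
    by rewrite min_l ?addr0; [split=> //; apply/andP; split; lra|lra].
  constructor 3; rewrite max_r ?max_l; [|lra|lra].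
  by rewrite min_r; [split; lra|lra].
have [[sa -> ->]|[/andP[sa1 sa2] -> ->]|[sa -> ->]] := E s s0;
have [[ta -> ->]|[/andP[ta1 ta2] -> ->]|[ta -> ->]] := E t (le_trans s0 st);
 (split; [lra|lra|lra|]); first [left; lra|right; apply/andP; split; lra].
Qed.

(** Between two points either dy = 0, or [a] separates the abscissas and thus lies within |dx| / 2
    of their mean. Both give the height condition of [l1_norm_monotone], so every arc has the least
    length |dx| + |dy|. *)
Lemma l1_dist_stair (a b s t : R) : 0 <= a -> 0 <= b -> 0 <= s -> 0 <= t ->
  l1_norm (heis_mul (heis_inv (stair a b s)) (stair a b t)) = `|t - s|.
Proof.
move=> a0 b0 s0 t0.
pose dx := stair_x a b t - stair_x a b s; pose dy := stair_y a b t - stair_y a b s.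
pose z := dy * (a - 2^-1 * (stair_x a b s + stair_x a b t)).
have -> : heis_mul (heis_inv (stair a b s)) (stair a b t) = (dx, dy, z).
  by apply: heis_eq; rewrite !heisE /hx /hy /hz /stair /= /z /dx /dy; field.
have [dxy dz] : `|dx| + `|dy| = `|t - s| /\
    (dy = 0 \/ `|a - 2^-1 * (stair_x a b s + stair_x a b t)| <= 2^-1 * `|dx|).
  have [st|ts] := leP s t.
    have [h1 h2 h3 h4] := stair_le a0 b0 s0 st.
    have [dx0 dy0] : 0 <= dx /\ 0 <= dy by rewrite !subr_ge0.
    rewrite (ger0_norm dx0) (ger0_norm dy0) ger0_norm ?subr_ge0//; split=> //.
    case: h4 => [h4|/andP[h4 h5]]; [left; rewrite /dy h4 subrr//|right].
    by rewrite ler_norml /dx; apply/andP; split; lra.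
  have [h1 h2 h3 h4] := stair_le a0 b0 t0 (ltW ts).
  have [dx0 dy0] : dx <= 0 /\ dy <= 0 by rewrite !subr_le0.
  rewrite (ler0_norm dx0) (ler0_norm dy0) ltr0_norm ?subr_lt0//.
  split; first by rewrite /dx /dy; lra.
  case: h4 => [h4|/andP[h4 h5]]; [left; rewrite /dy h4 subrr//|right].
  by rewrite ler_norml /dx; apply/andP; split; lra.
apply/eqP; rewrite eq_le -dxy; apply/andP; split; last exact: l1_norm_ge (dx, dy, z).
apply: l1_norm_monotone; rewrite /z; case: dz => [->|dz].
  by rewrite mul0r mulr0 normr0 mulr0.
by rewrite !normrM mulrA mulrC ler_wpM2r.
Qed.

Definition clamp01 (t : R) : R := Num.max 0 (Num.min t 1).

Lemma clamp01_itv t : 0 <= clamp01 t <= 1.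
Proof. by rewrite /clamp01 le_max lexx ge_max ler01 ge_min lexx orbT. Qed.

Lemma clamp01_id t : 0 <= t <= 1 -> clamp01 t = t.
Proof. by move=> /andP[t0 t1]; rewrite /clamp01 min_l// max_r. Qed.

Lemma to_l1_inv p g : to_l1 p (heis_inv g) = heis_inv (to_l1 p g).
Proof. by case: p; apply: heis_eq; rewrite !heisE; ring. Qed.

(** The staircase run at speed [l] from [k]; the clamp is the constant extension outside [0, 1]
    required in [geodesics]. *)
Definition stair_curve p (k : heis R) (a b l : R) (s : R) : heis R :=
  heis_mul k (of_l1 p (stair a b (l * clamp01 s))).

Lemma stair_curve_dist p k (a b l s t : R) : 0 <= a -> 0 <= b -> 0 <= l ->
  heis_dist p (stair_curve p k a b l s) (stair_curve p k a b l t) =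
  l * `|clamp01 t - clamp01 s|.
Proof.
move=> a0 b0 l0; have [/andP[cs _] /andP[ct _]] := (clamp01_itv s, clamp01_itv t).
rewrite heis_distE /stair_curve.
rewrite (_ : heis_mul _ _ = heis_mul (heis_inv (of_l1 p (stair a b (l * clamp01 s))))
  (of_l1 p (stair a b (l * clamp01 t)))); last by apply: heis_eq; rewrite !heisE; ring.
rewrite to_l1M to_l1_inv !of_l1K l1_dist_stair ?mulr_ge0//.
by rewrite -mulrBr normrM (ger0_norm l0).
Qed.

Lemma stair_curve_geodesic p k (a b l : R) : 0 <= a -> 0 <= b -> 0 <= l ->
  geodesics (heis_dist p) (stair_curve p k a b l).
Proof.
move=> a0 b0 l0; split=> [s t s01 t01|t].
  rewrite !stair_curve_dist// !clamp01_id ?lexx ?ler01//.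
  by rewrite subr0 normr1 mulr1 mulrC.
by rewrite /stair_curve -/(clamp01 t) (clamp01_id (clamp01_itv t)).
Qed.

Lemma stair_curve0 p k (a b l : R) : 0 <= a -> 0 <= b -> stair_curve p k a b l 0 = k.
Proof.
move=> a0 b0; rewrite /stair_curve clamp01_id ?lexx ?ler01// mulr0 /stair /stair_x /stair_y.
rewrite (min_l a0) (@max_l _ _ 0); last by lra.
rewrite (@max_r _ _ _ 0) ?(min_l b0); last by lra.
by apply: heis_eq; case: p; rewrite !heisE /hx /hy /hz /=; ring.
Qed.

(** Monotone staircases sweep a full-dimensional region: [a] is the abscissa of [reach_swept], and
    the bound on [z] puts it in [0, x]. *)
Lemma stair_reach (x y z : R) : 0 < x -> 0 < y -> `|z| <= 2^-1 * (x * y) ->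
  let a := 2^-1 * x + z / y in
  [/\ 0 <= a, a <= x & stair a y (x + y) = (x, y, z)].
Proof.
move=> x0 y0 zxy a.
have zy : `|z / y| <= 2^-1 * x.
  by rewrite normrM normfV (gtr0_norm y0) ler_pdivrMr// -mulrA.
move: zy; rewrite ler_norml => /andP[h1 h2].
have [a0 ax] : 0 <= a /\ a <= x by rewrite /a; split; lra.
split=> //; rewrite /stair /stair_x /stair_y.
rewrite (@min_r _ _ (x + y) a); last by lra.
rewrite (@max_r _ _ 0); last by lra.
rewrite (@max_l _ _ (x + y - a)); last by lra.
rewrite (@min_r _ _ _ y); last by lra.
by apply: heis_eq; rewrite /hx /hy /hz /=; rewrite ?/a; field; rewrite ?gt_eqF.
Qed.

End geodesics_of_heisenberg.

(** * Volumes of boxes *)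

Section heisenberg_measure.
Variable R : realType.
Notation mu := (@lebesgue_measure R).
Notation m := (heis_lebesgue R).
Implicit Types (g h k : heis R).

Lemma measurable_hx : measurable_fun setT (@hx R : heis R -> measurableTypeR R).
Proof. exact: (measurableT_comp measurable_fst measurable_fst). Qed.

Lemma measurable_hy : measurable_fun setT (@hy R : heis R -> measurableTypeR R).
Proof. exact: (measurableT_comp measurable_snd measurable_fst). Qed.

Lemma measurable_hz : measurable_fun setT (@hz R : heis R -> measurableTypeR R).
Proof. exact: measurable_snd. Qed.

(** The left translate by [k] of a coordinate box, the shape of balls up to constants; in the
    coordinates of R^3 it is sheared in z. *)
Definition heis_box k (x1 x2 y1 y2 z1 z2 : R) : set (heis R) :=
  [set g | let q := heis_mul (heis_inv k) g in
    [/\ x1 <= hx q <= x2, y1 <= hy q <= y2 & z1 <= hz q <= z2]].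

Lemma heis_boxE k (x1 x2 y1 y2 z1 z2 : R) : heis_box k x1 x2 y1 y2 z1 z2 =
  (@hx R : heis R -> measurableTypeR R) @^-1` `[hx k + x1, hx k + x2] `&`
  (@hy R : heis R -> measurableTypeR R) @^-1` `[hy k + y1, hy k + y2] `&`
  (fun g => hz g - 2^-1 * (hx k * hy g - hx g * hy k) : measurableTypeR R) @^-1`
    `[hz k + z1, hz k + z2].
Proof.
have sh (a b c d : R) : (a <= - d + b <= c) = (b \in `[d + a, d + c]).
  by rewrite in_itv/= addrC lerBrDr lerBlDr ![_ + d]addrC.
have zE g : hz g - hz k - 2^-1 * (hx k * hy g - hx g * hy k) =
  - hz k + (hz g - 2^-1 * (hx k * hy g - hx g * hy k)) by ring.
apply/seteqP; split=> g.
  by move=> []; rewrite hx_mul hy_mul hz_mulVl hx_inv hy_inv zE !sh.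
move=> [[h1 h2] h3]; rewrite /heis_box/mkset hx_mul hy_mul hz_mulVl hx_inv hy_inv zE !sh.
by split.
Qed.

Lemma measurable_heis_box k (x1 x2 y1 y2 z1 z2 : R) :
  measurable (heis_box k x1 x2 y1 y2 z1 z2).
Proof.
rewrite heis_boxE; apply: measurableI; first apply: measurableI.
- by rewrite -[X in measurable X]setTI; apply: measurable_hx => //; exact: measurable_itv.
- by rewrite -[X in measurable X]setTI; apply: measurable_hy => //; exact: measurable_itv.
- rewrite -[X in measurable X]setTI.
  suff mf : measurable_fun setT
    (fun g => hz g - 2^-1 * (hx k * hy g - hx g * hy k) : measurableTypeR R).
    by apply: mf => //; exact: measurable_itv.
  apply: measurable_funB; first exact: measurable_hz.
  apply: measurable_funM => //; apply: measurable_funB; apply: measurable_funM => //.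
    exact: measurable_hy.
  exact: measurable_hx.
Qed.

Lemma lebesgue_itvcc (a b : R) : a <= b -> mu `[a, b] = (b - a)%:E.
Proof.
move=> ab; rewrite lebesgue_measure_itv/= lte_fin lt_neqAle ab andbT.
by case: eqP => [->|_]; rewrite ?subrr// EFinB.
Qed.

(** Left translation shears z by an affine function of (x, y): the vertical sections over a fixed
    rectangle are intervals of the same length, and Fubini applies. *)
Lemma heis_lebesgue_box k (x1 x2 y1 y2 z1 z2 : R) :
  x1 <= x2 -> y1 <= y2 -> z1 <= z2 ->
  m (heis_box k x1 x2 y1 y2 z1 z2) = ((x2 - x1) * (y2 - y1) * (z2 - z1))%:E.
Proof.
move=> x12 y12 z12.
pose D : set (measurableTypeR R * measurableTypeR R) :=
  `[hx k + x1, hx k + x2] `*` `[hy k + y1, hy k + y2].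
have mD : measurable D by apply: measurableX; exact: measurable_itv.
have sec xy : mu (xsection (heis_box k x1 x2 y1 y2 z1 z2) xy) =
    ((z2 - z1)%:E * (\1_D xy)%:E)%E.
  have [xyD|xyD] := pselect (D xy); last first.
    rewrite indicE memNset// mule0 (_ : xsection _ _ = set0) ?measure0//.
    apply/seteqP; split=> // z; rewrite /xsection/= inE heis_boxE => -[[h1 h2] _].
    by apply: xyD; split.
  rewrite indicE mem_set// mule1.
  pose c := 2^-1 * (hx k * xy.2 - xy.1 * hy k).
  rewrite (_ : xsection _ _ = `[hz k + z1 + c, hz k + z2 + c]%classic).
    rewrite lebesgue_itvcc; first by congr (_%:E); ring.
    by rewrite lerD2r lerD2l.
  apply/seteqP; split=> z; rewrite /xsection/= inE heis_boxE.
    move=> [_ /=]; rewrite !in_itv/= /hz /hx /hy /= -/c => /andP[h1 h2].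
    by rewrite -lerBrDr h1 -lerBlDr h2.
  rewrite in_itv/= => /andP[h1 h2]; split; first by case: xyD.
  by change (z - c \in `[hz k + z1, hz k + z2]); rewrite in_itv/= lerBrDr h1 lerBlDr h2.
rewrite [LHS](_ : _ = (\int[mu \x mu]_xy ((z2 - z1)%:E * (\1_D xy)%:E))%E); last first.
  by apply: eq_integral => xy _; exact: sec.
have muD : (mu \x mu)%E D = ((x2 - x1) * (y2 - y1))%:E.
  rewrite product_measure1E; [|exact: measurable_itv..].
  rewrite -[X in (X * _)%E]/(mu `[hx k + x1, hx k + x2]) -[X in (_ * X)%E]/(mu `[hy k +
    y1, hy k + y2]).
  rewrite !lebesgue_itvcc ?lerD2l// -EFinM; congr (_%:E); ring.
rewrite ge0_integralZl//=.
- have := @integral_indic _ _ R (mu \x mu)%E setT measurableT D mD.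
  rewrite setIT => ->; rewrite -[X in (_ * X)%E]/((mu \x mu)%E D) muD.
  by rewrite -EFinM mulrC.
- by apply/measurable_EFinP; exact: measurable_indic.
- by rewrite lee_fin subr_ge0.
Qed.

Lemma heis_lebesgue_z0 : m [set g | hz g = 0] = 0%E.
Proof.
have -> : [set g : heis R | hz g = 0] = setT `*` [set 0].
  by apply/seteqP; split=> [g|g []]//=.
rewrite [LHS]product_measure1E; [|exact: measurableT|exact: measurable_set1].
have mu0 : mu [set 0] = 0%E by exact: lebesgue_measure_set1.
by rewrite [X in (_ * X)%E](_ : _ = 0%E) ?mule0.
Qed.

Lemma measurable_z0 : measurable [set g : heis R | hz g = 0].
Proof.
rewrite -[X in measurable X]setTI (_ : mkset _ = (@hz R : heis R -> measurableTypeR R)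
  @^-1` [set 0])//.
by apply: measurable_hz => //; exact: measurable_set1.
Qed.

Lemma outer_le_heis_box (A : set (heis R)) k (x1 x2 y1 y2 z1 z2 : R) :
  x1 <= x2 -> y1 <= y2 -> z1 <= z2 -> A `<=` heis_box k x1 x2 y1 y2 z1 z2 ->
  ((m^*)%mu A <= ((x2 - x1) * (y2 - y1) * (z2 - z1))%:E)%E.
Proof.
move=> x12 y12 z12 /(le_mu_ext m) h; apply: (le_trans h).
rewrite measurable_mu_extE; last exact: measurable_heis_box.
by rewrite -[leLHS]/(m _) heis_lebesgue_box.
Qed.

Lemma outer_ge_heis_box (A : set (heis R)) k (x1 x2 y1 y2 z1 z2 : R) :
  x1 <= x2 -> y1 <= y2 -> z1 <= z2 -> heis_box k x1 x2 y1 y2 z1 z2 `<=` A ->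
  (((x2 - x1) * (y2 - y1) * (z2 - z1))%:E <= (m^*)%mu A)%E.
Proof.
move=> x12 y12 z12 /(le_mu_ext m); apply: le_trans.
rewrite measurable_mu_extE; last exact: measurable_heis_box.
by rewrite -[leRHS]/(m _) heis_lebesgue_box.
Qed.

End heisenberg_measure.

(** * Failure of the measure contraction property *)

Section mcp_weights.
Variable R : realType.

(* [f] need not be measurable: the integral of a nonnegative function is a
   supremum over simple functions below it. *)
Lemma mule_measure_le_integral d (T : measurableType d)
    (P : {measure set T -> \bar R}) (f : T -> \bar R) (E D : set T) (c : R) :
  measurable E -> E `<=` D -> 0 <= c ->
  (forall x, D x -> (0 <= f x)%E) -> (forall x, E x -> (c%:E <= f x)%E) ->
  (c%:E * P E <= \int[P]_(x in D) f x)%E.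
Proof.
move=> mE ED c0 f0 cf; rewrite ge0_integralE//.
pose h := scale_nnsfun (indic_nnsfun R mE) c0.
apply: ereal_sup_ubound; exists h => [x|].
  change ((c * \1_E x)%:E <= (f \_ D) x)%E; rewrite patchE indicE.
  have [Ex|nEx] := boolP (x \in E).
    by rewrite mem_set ?mulr1; [apply: cf; exact: set_mem|apply: ED; exact: set_mem].
  by rewrite mulr0; case: ifPn => // /set_mem; exact: f0.
by rewrite (sintegralrM P c (indic_nnsfun R mE)) sintegral_indic.
Qed.

(** For K > 0 the choice X0 = 1 / sqrt K keeps the argument of the sine in [0, 1], inside the
    interval below pi / 2 where it increases. *)
Lemma sK_increasing (K : R) : exists2 X0 : R, 0 < X0 &
  (0 < K -> Num.sqrt K * X0 < pi) /\
  (forall x y : R, 0 < x -> x <= y -> y <= X0 -> 0 < sK K x /\ sK K x <= sK K y).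
Proof.
rewrite /sK; have [K0|K0] := ltP 0 K.
  have k0 : 0 < Num.sqrt K by rewrite sqrtr_gt0.
  exists (Num.sqrt K)^-1; first by rewrite invr_gt0.
  rewrite divff ?gt_eqF//; split=> [_|x y x0 xy yX].
    by rewrite (lt_le_trans _ (pi_ge2 R))// ltr1n.
  have ky : Num.sqrt K * y <= 1 by rewrite mulrC -ler_pdivlMr// mul1r.
  have kxy : Num.sqrt K * x <= Num.sqrt K * y by rewrite ler_pM2l.
  have kx : 0 < Num.sqrt K * x by rewrite mulr_gt0.
  have ph := pihalf_ge1 R.
  split.
    rewrite divr_gt0// sin_gt0_pi// kx/=; have := pi_ge2 R; lra.
  rewrite ler_pM2r ?invr_gt0//.
  move: kxy; rewrite le_eqVlt => /predU1P[->//|kxy]; apply: ltW.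
  by rewrite ltr_sin// in_itv/=; apply/andP; split; lra.
exists 1 => //; split=> // x y x0 xy _.
case: eqP => [_|K0']; first by [].
have k0 : 0 < Num.sqrt (- K).
  by rewrite sqrtr_gt0 oppr_gt0 lt_neqAle K0 andbT; apply/eqP.
have kxy : Num.sqrt (- K) * x <= Num.sqrt (- K) * y by rewrite ler_pM2l.
have kx : 0 < Num.sqrt (- K) * x by rewrite mulr_gt0.
split.
  by rewrite divr_gt0// divr_gt0// subr_gt0 ltr_expR; lra.
rewrite ler_pM2r ?invr_gt0// ler_pM2r ?invr_gt0// lerB// ler_expR//.
by rewrite lerN2.
Qed.

(** For N <> 1 the scale is set by 120 s / sqrt (N - 1) = X0, so that all arguments stay where [sK]
    increases and [c] is the bracket with the extreme values in numerator and denominator. The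
    factor 120 is the ratio of the bounds in [mcp_box_dist]. *)
Lemma MCP_bracket_ge (K N t : R) : MCP_pair K N -> 0 < t -> t < 1 ->
  exists2 s : R, 0 < s &
    (0 < K -> 120 * s < pi * Num.sqrt ((N - 1) / K)) /\
    exists2 c : R, 0 < c & forall l, s <= l -> l <= 120 * s ->
      c <= MCP_bracket K N t l.
Proof.
move=> KN t0 t1; rewrite /MCP_bracket; have [N1|N1] := eqVneq N 1.
  exists 1 => //; split; last by exists 1.
  by case: KN => [|[K0 _ K0']]; [rewrite N1 ltxx|move: (lt_le_trans K0' K0); rewrite ltxx].
have N1' : 0 < N - 1.
  by rewrite subr_gt0; case: KN => [//|[_ NE]]; rewrite NE eqxx in N1.
pose n := Num.sqrt (N - 1); have n0 : 0 < n by rewrite sqrtr_gt0.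
have [X0 X00 [Xpi sKX]] := sK_increasing K.
pose s := X0 * n / 120; have s0 : 0 < s by rewrite /s divr_gt0// mulr_gt0.
have sE : 120 * s / n = X0 by rewrite /s; field; rewrite gt_eqF.
exists s => //; split=> [K0|].
  rewrite sqrtrM ?(ltW N1')// sqrtrV ?(ltW K0)// -/n.
  rewrite [ltRHS]mulrA ltr_pdivlMr ?sqrtr_gt0// -ltr_pdivrMr//.
  by rewrite mulrAC sE mulrC Xpi.
have tsn0 : 0 < t * s / n by rewrite divr_gt0// mulr_gt0.
have tsX : t * s / n <= X0.
  by rewrite -sE ler_pM2r ?invr_gt0// ler_pM2r//; lra.
have [a0 _] := sKX _ _ tsn0 (lexx _) tsX.
have [b0 _] := sKX _ _ X00 (lexx _) (lexx _).
exists ((sK K (t * s / n) / sK K X0) `^ (N - 1)); first by rewrite powR_gt0// divr_gt0.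
move=> l sl lX.
have l0 : 0 < l by exact: lt_le_trans sl.
have lnX : l / n <= X0 by rewrite -sE ler_pM2r ?invr_gt0.
have tln : t * s / n <= t * l / n by rewrite ler_pM2r ?invr_gt0// ler_pM2l.
have tlX : t * l / n <= X0.
  by rewrite (le_trans _ lnX)// ler_pM2r ?invr_gt0// ler_piMl ?ltW.
have [_ h1] := sKX _ _ tsn0 tln tlX.
have ln0 : 0 < l / n by rewrite divr_gt0.
have [h2 h3] := sKX _ _ ln0 lnX (lexx _).
rewrite (gt_eqF h2) andbF ge0_ler_powR ?nnegrE ?(ltW N1')//.
- by rewrite divr_ge0// ltW.
- by rewrite divr_ge0// ltW// (lt_le_trans a0).
- by apply: ler_pM; [exact: ltW|rewrite invr_ge0 ltW|exact: h1|rewrite lef_pV2 ?posrE].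
Qed.

End mcp_weights.

(** * A box whose points are reached only through a null set *)

Section mcp_failure.
Variable R : realType.
Notation m := (heis_lebesgue R).
Implicit Types (g h k : heis R) (p : exponent1oo).

(* [to_l1 p] maps this box into the region of [geodesic_initial_segment]. *)
Definition mcp_box p (s : R) : set (heis R) :=
  match p with
  | Exponent1 => heis_box (heis0 R) s (2 * s) (9 * s) (10 * s)
                   (10 * s ^+ 2) (20 * s ^+ 2)
  | Exponentoo => heis_box (heis0 R) (106 / 10 * s) (114 / 10 * s)
      (- (84 / 10) * s) (- (76 / 10) * s) (- 40 * s ^+ 2) (- 20 * s ^+ 2)
  end.

Lemma heis_mulV0 g : heis_mul (heis_inv (heis0 R)) g = g.
Proof. by apply: heis_eq; rewrite !heisE; ring. Qed.

Lemma heis_box0E (x1 x2 y1 y2 z1 z2 : R) g :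
  heis_box (heis0 R) x1 x2 y1 y2 z1 z2 g <->
  [/\ x1 <= hx g <= x2, y1 <= hy g <= y2 & z1 <= hz g <= z2].
Proof. by rewrite /heis_box /mkset heis_mulV0. Qed.

Lemma mcp_box_to_l1 p (s : R) g : 0 < s -> mcp_box p s g ->
  exists X Y Z : R, [/\ to_l1 p g = (X, Y, Z), s <= X <= 2 * s,
    9 * s <= Y <= 10 * s & 10 * s ^+ 2 <= Z <= 20 * s ^+ 2].
Proof.
move=> s0; case: p => /heis_box0E[/andP[x1 x2] /andP[y1 y2] /andP[z1 z2]].
  exists (hx g), (hy g), (hz g); split; rewrite ?x1 ?y1 ?z1//.
  by apply: heis_eq; rewrite !heisE /hx /hy /hz /=; ring.
(* The square of centre (11 s, - 8 s) and half side 0.4 s is sent into the square of centre (1.5 s,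
   9.5 s) with the same half side; z is multiplied by the determinant - 1 / 2. *)
exists (2^-1 * (hx g + hy g)), (2^-1 * (hx g - hy g)), (- (2^-1 * hz g)); split.
- by apply: heis_eq; rewrite !heisE /hx /hy /hz /=; field.
- by apply/andP; split; lra.
- by apply/andP; split; lra.
- by apply/andP; split; lra.
Qed.

Lemma mcp_box_dist p (s : R) g : 0 < s -> mcp_box p s g ->
  s <= heis_dist p (heis0 R) g <= 120 * s.
Proof.
move=> s0 gA; apply/andP; split.
  rewrite heis_distE heis_mulV0.
  have [X [Y [Z [-> /andP[X1 X2] _ _]]]] := mcp_box_to_l1 s0 gA.
  have := l1_norm_ge (X, Y, Z); rewrite /hx /hy /=.
  by have := ler_norm X; have := normr_ge0 Y; lra.
(* [heis_dist_coord_le] with radius 12 s: the horizontal coordinates are at most 11.4 s and |z| is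
   at most 40 s^2. *)
rewrite (_ : 120 * s = 10 * (12 * s)); last by ring.
apply: heis_dist_coord_le; rewrite ?hx0 ?hy0 ?hz0 ?mul0r ?mulr0 ?subr0 ?mulr0 ?subr0.
- by rewrite mulr_ge0// ltW.
- case: p gA => /heis_box0E[/andP[x1 x2] /andP[y1 y2] /andP[z1 z2]];
  by rewrite ler_norml; apply/andP; split; lra.
- case: p gA => /heis_box0E[/andP[x1 x2] /andP[y1 y2] /andP[z1 z2]];
  by rewrite ler_norml; apply/andP; split; lra.
- rewrite exprMn; have := sqr_ge0 s.
  case: p gA => /heis_box0E[/andP[x1 x2] /andP[y1 y2] /andP[z1 z2]] ?;
  by rewrite ler_norml; apply/andP; split; lra.
Qed.

Lemma mcp_box_measure p (s : R) : 0 < s ->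
  (0 < m (mcp_box p s) < +oo)%E.
Proof.
move=> s0; have s20 : 0 < s ^+ 2 by rewrite exprn_gt0.
by case: p; rewrite /mcp_box heis_lebesgue_box ?ltry ?andbT ?lte_fin ?mulr_gt0//; lra.
Qed.

(** The length is at most 120 s, so [g t] is within s / 100 of the origin, and along a geodesic the
    distances through [g t] add up exactly: this is the situation of [geodesic_initial_segment]. *)
Lemma mcp_box_geodesic p (s t : R) (g : R -> heis R) : 0 < s ->
  0 <= t -> 120 * t <= 100^-1 ->
  geodesics (heis_dist p) g -> g 0 = heis0 R -> mcp_box p s (g 1) ->
  hz (g t) = 0.
Proof.
move=> s0 t0 t1 [geo _] g0 gA.
have t01 : 0 <= t <= 1 by apply/andP; split; lra.
have z01 : 0 <= (0 : R) <= 1 by rewrite lexx ler01.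
have o01 : 0 <= (1 : R) <= 1 by rewrite lexx ler01.
have dt := geo _ _ z01 t01; have dt1 := geo _ _ t01 o01.
have [X [Y [Z [lE hX hY hZ]]]] := mcp_box_to_l1 s0 gA.
have /andP[_ ds] := mcp_box_dist s0 gA.
rewrite subr0 g0 in dt dt1.
have ge0 : 0 <= heis_dist p (heis0 R) (g 1) := heis_dist_ge0 _ _ _.
move: ds ge0 dt dt1; set l := heis_dist p (heis0 R) (g 1).
rewrite !heis_distE heis_mulV0 to_l1M to_l1_inv lE.
have -> : l = l1_norm (X, Y, Z) by rewrite /l heis_distE heis_mulV0 lE.
case E : (to_l1 p (g t)) => [[x y] z].
move=> ds l0 dt dt1.
have z0 : z = 0.
  apply: (@geodesic_initial_segment R s x y z X Y Z) => //.
    rewrite dt ger0_norm// (le_trans (ler_wpM2l t0 ds))// mulrA [t * _]mulrC.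
    by rewrite ler_wpM2r// ltW.
  rewrite dt dt1 (ger0_norm t0) ger0_norm ?subr_ge0; last by case/andP: t01.
  by rewrite -mulrDl addrC subrK mul1r.
have : g t = of_l1 p (x, y, z) by rewrite -E to_l1K.
by move=> ->; rewrite z0; case: (p); rewrite /of_l1 !heisE /hz /= mulr0.
Qed.

Definition geo_ev p (g0 : geodesics (heis_dist (R := R) p)) (t : R)
  (g : borel_geodesics g0) : heis R := eval_at t g.

Lemma measurable_open_geodesics p (g0 : geodesics (heis_dist (R := R) p))
  (U : set (borel_geodesics g0)) : geodesics_open U -> measurable U.
Proof. by move=> oU; apply: sub_sigma_algebra. Qed.

(** The complement is open: a geodesic starting off the origin keeps doing so under a uniform
    perturbation smaller than the distance of its start to the origin. *)
Lemma measurable_eval0 p (g0 : geodesics (heis_dist (R := R) p)) :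
  measurable (geo_ev (g0 := g0) 0 @^-1` [set heis0 R]).
Proof.
rewrite -[X in measurable X]setCK; apply: measurableC; apply: measurable_open_geodesics.
move=> g /= ng; exists (heis_dist p (val g 0) (heis0 R)).
  rewrite lt_neqAle heis_dist_ge0 andbT; apply/eqP => d0; apply: ng.
  exact/esym/esym/(heis_dist_eq0 (esym d0)).
move=> h gh h0; have := gh 0; rewrite lexx ler01 => /(_ isT).
by rewrite [val h 0]h0 ltxx.
Qed.

Lemma heis_dist_coord_continuous p g (n : R) : 0 < n ->
  exists2 e : R, 0 < e & forall h, heis_dist p g h < e ->
    [/\ `|hx h - hx g| < n, `|hy h - hy g| < n & `|hz h - hz g| < n].
Proof.
move=> n0; pose C := 4 + `|hx g| + `|hy g|.
have C0 : 4 <= C by rewrite /C -addrA lerDl addr_ge0.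
have C0' : 0 < C by lra.
exists (Num.min 1 (n / C)) => [|h]; first by rewrite lt_min ltr01 divr_gt0.
rewrite lt_min => /andP[d1]; rewrite ltr_pdivlMr// => dn.
have d0 : 0 <= heis_dist p g h := heis_dist_ge0 _ _ _.
have [h1 h2 h3] := heis_dist_coord_ge p g h.
set d := heis_dist p g h in d1 dn d0 h1 h2 h3.
have d4 : 4 * d <= d * C by rewrite mulrC ler_wpM2l.
split; [by lra|by lra|].
have -> : hz h - hz g = (hz h - hz g - 2^-1 * (hx g * hy h - hx h * hy g)) +
  2^-1 * (hx g * (hy h - hy g) - (hx h - hx g) * hy g) by ring.
rewrite (le_lt_trans (ler_normD _ _))//.
have : `|2^-1 * (hx g * (hy h - hy g) - (hx h - hx g) * hy g)| <=
    2^-1 * (`|hx g| * d + `|hy g| * d).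
  rewrite normrM (ger0_norm (_ : 0 <= 2^-1))// ler_pM2l// (le_trans (ler_normB _ _))//.
  by rewrite !normrM lerD// ?ler_wpM2l// mulrC ler_wpM2l.
have dd : d ^+ 2 <= d by rewrite expr2 ler_piMl// ltW.
have : 0 <= `|hx g| * d + `|hy g| * d by rewrite addr_ge0// mulr_ge0.
move: h3 dn; rewrite /C; set u := `|_ - _ - _|; set v := `|2^-1 * _|.
by move=> *; lra.
Qed.

(* A coordinate box based at the origin is closed for the distance. *)
Lemma measurable_eval1 p (g0 : geodesics (heis_dist (R := R) p)) (x1 x2 y1 y2 z1 z2 : R) :
  measurable (geo_ev (g0 := g0) 1 @^-1` heis_box (heis0 R) x1 x2 y1 y2 z1 z2).
Proof.
rewrite -[X in measurable X]setCK; apply: measurableC; apply: measurable_open_geodesics.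
move=> g /= ng.
have cl (q : heis R) : ~ heis_box (heis0 R) x1 x2 y1 y2 z1 z2 q -> exists2 e, 0 < e &
    forall h, heis_dist p q h < e -> ~ heis_box (heis0 R) x1 x2 y1 y2 z1 z2 h.
  move=> nq; apply: contrapT => far; apply: nq.
  have near_box (n : R) : 0 < n -> exists h, [/\ heis_box (heis0 R) x1 x2 y1 y2 z1 z2 h,
      `|hx h - hx q| < n, `|hy h - hy q| < n & `|hz h - hz q| < n].
    move=> n0; have [e e0 He] := heis_dist_coord_continuous p q n0.
    apply: contrapT => nh; apply: far; exists e => // h /He[h1 h2 h3] hB.
    by apply: nh; exists h.
  apply/heis_box0E; split; apply/andP; split; apply/ler_addgt0Pl => e /near_box[h [/heis_box0E
    [/andP[? ?] /andP[? ?] /andP[? ?]]]]; rewrite !ltr_norml => /andP[? ?] /andP[? ?]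
      /andP[? ?]; lra.
have [e e0 He] := cl _ ng; exists e => // h gh; apply: He.
by apply: gh; rewrite ler01 lexx.
Qed.

Lemma measurable_eval_mcp_box p (g0 : geodesics (heis_dist (R := R) p)) (s : R) :
  measurable (geo_ev (g0 := g0) 1 @^-1` mcp_box p s).
Proof. by case: p g0 => g0; exact: measurable_eval1. Qed.

Lemma measurable_set1_heis g : measurable [set g].
Proof.
have -> : [set g] = heis_box g 0 0 0 0 0 0.
  apply/seteqP; split=> h; rewrite /heis_box /mkset.
    by move=> ->; rewrite heis_mulVg hx0 hy0 hz0 lexx.
  rewrite -!eq_le => -[/eqP h1 /eqP h2 /eqP h3].
  have e : heis_mul (heis_inv g) h = heis0 R by exact: heis_eq.
  by rewrite /= -(heis_mulKV g h) e; apply: heis_eq; rewrite !heisE; ring.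
exact: measurable_heis_box.
Qed.

(** Almost every geodesic of the given probability starts at the origin and ends in the box, hence
    lies in {z = 0} at time [t]. The contraction inequality for this null set has the positive left
    side of at least t c m(A). *)
Theorem not_MCP p (K N : R) : MCP_pair K N -> ~ MCP (heis_dist p) m K N.
Proof.
move=> KN mcp; pose t : R := (120 * 100)^-1.
have t0 : 0 < t by rewrite invr_gt0 mulr_gt0.
have t120 : 120 * t <= 100^-1 by rewrite /t; lra.
have t1 : t < 1 by lra.
have [s s0 [sK [c c0 cle]]] := MCP_bracket_ge KN t0 t1.
have mA := mcp_box_measure p s0.
have measA : measurable (mcp_box p s).
  by rewrite /mcp_box; case: (p); exact: measurable_heis_box.
have [|g0 [P [P0 P1 Pt]]] := mcp (heis0 R) (mcp_box p s) measA mA.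
  move=> K0 g /(mcp_box_dist s0)/andP[_ /le_lt_trans]; apply; exact: sK.
pose E0 := geo_ev (g0 := g0) 0 @^-1` [set heis0 R].
pose E1 := geo_ev (g0 := g0) 1 @^-1` mcp_box p s.
have mE0 : measurable E0 by exact: measurable_eval0.
have mE1 : measurable E1 by exact: measurable_eval_mcp_box.
have PE0 : P E0 = 1%E.
  have := P0 _ (measurable_set1_heis (heis0 R)).
  by rewrite diracE mem_set.
have mAf : m (mcp_box p s) \is a fin_num.
  by case/andP: mA => a0 aoo; rewrite ge0_fin_numE// ltW.
have mA0 : m (mcp_box p s) != 0%E by case/andP: mA => a0 _; rewrite gt_eqF.
have PE1 : P E1 = 1%E.
  by have := P1 _ measA; rewrite setIid mulVe.
have PE : (1 <= P (E0 `&` E1))%E.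
  have PC1 : P (~` E1) = 0%E.
    have := probability_setC P mE1; rewrite PE1 => ->.
    by rewrite subee.
  rewrite -PE0 -[leRHS]adde0 -PC1.
  have mE : measurable (E0 `&` E1) by exact: measurableI.
  apply: le_trans (measureU2 _ mE (measurableC mE1)).
  apply: le_measure; rewrite ?inE//; first by apply: measurableU => //; exact: measurableC.
  by move=> g gE0; have [?|?] := pselect (E1 g); [left|right].
have t01 : 0 <= t <= 1 by rewrite (ltW t0) (ltW t1).
have := Pt t t01 _ (@measurable_z0 R).
rewrite heis_lebesgue_z0; apply/negP; rewrite -ltNge.
have [r r0 mAE] : exists2 r : R, 0 < r & m (mcp_box p s) = r%:E.
  exists (fine (m (mcp_box p s))); last by rewrite fineK.
  by apply: fine_gt0.
have tcr : 0 < t * c * r by rewrite !mulr_gt0.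
rewrite mAE; apply: (@lt_le_trans _ _ ((t * c * r)%:E * P (E0 `&` E1))%E).
  by rewrite mule_gt0 ?lte_fin// (lt_le_trans _ PE).
apply: mule_measure_le_integral.
- exact: measurableI.
- move=> g [gE0 gE1]; apply: (@mcp_box_geodesic p s t (val g)) => //; first exact: ltW.
  exact: set_valP.
- exact: ltW.
- move=> g _; rewrite -EFinM lee_fin !mulr_ge0 ?(ltW t0) ?(ltW r0)//.
  by rewrite /MCP_bracket; case: ifP => // _; exact: powR_ge0.
- move=> g [gE0 gE1]; rewrite -EFinM lee_fin ler_wpM2r ?(ltW r0)// ler_wpM2l ?(ltW t0)//.
  have /andP[l1 l2] := mcp_box_dist s0 gE1.
  have lE : geodesic_length g = heis_dist p (heis0 R) (val g 1).
    by rewrite /geodesic_length /eval_at [val g 0]gE0.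
  by apply: cle; rewrite lE.
Qed.

End mcp_failure.

(** * Geodesic dimension *)

Section geodesic_dimension.
Variable R : realType.
Notation m := (heis_lebesgue R).
Implicit Types (g h k : heis R) (p : exponent1oo).

Lemma heis_dist_left p k g h :
  heis_dist p (heis_mul k g) (heis_mul k h) = heis_dist p g h.
Proof.
rewrite !heis_distE; congr (l1_norm (to_l1 p _)).
by apply: heis_eq; rewrite !heisE; ring.
Qed.

(* Points of this box, whose volume is of order [t ^ 4], are the ends of staircases
   that reach [target_box k] at time 1. *)
Definition spread_box p k (t : R) : set (heis R) :=
  match p with
  | Exponent1 => heis_box k t (2 * t) t (2 * t) (- (t ^+ 2 / 2)) (t ^+ 2 / 2)
  | Exponentoo => heis_box k (11 / 4 * t) (13 / 4 * t) (- (t / 4)) (t / 4)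
                    (- (t ^+ 2 / 2)) (t ^+ 2 / 2)
  end.

Definition target_box k : set (heis R) := heis_box k (-20) 20 (-20) 20 (-20) 20.

Lemma stair_endpoint (a b l : R) : 0 <= a -> 0 <= b -> a + b <= l ->
  stair a b l = (l - b, b, 2^-1 * (b * (2 * a - (l - b)))).
Proof.
move=> a0 b0 abl; rewrite /stair /stair_x /stair_y.
rewrite (@min_r _ _ l a); last by lra.
rewrite (@max_r _ _ 0); last by lra.
rewrite (@max_l _ _ (l - a)); last by lra.
rewrite (@min_r _ _ _ b); last by lra.
by rewrite (_ : a + (l - a - b) = l - b)//; ring.
Qed.

(** Seen from [k] in the coordinates of [to_l1], a point of the box is the end of a monotone
    staircase by [stair_reach]; the staircase goes on along its last side and remains minimising. *)
Lemma spread_box_intermediate p k (t : R) : 0 < t -> t <= 1 ->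
  spread_box p k t `<=` intermediate_set (heis_dist p) k (target_box k) t.
Proof.
move=> t0 t1 q qS.
have t20 : 0 < t ^+ 2 by rewrite exprn_gt0.
have [a [b [c [E /andP[a1 a2] /andP[b1 b2] cab]]]] : exists a b c : R,
    [/\ to_l1 p (heis_mul (heis_inv k) q) = (a, b, c), t <= a <= 2 * t,
      t <= b <= 2 * t & `|c| <= 2^-1 * (a * b)].
  have tab (a b : R) : t <= a -> t <= b -> t ^+ 2 <= a * b.
    by move=> ta tb; rewrite expr2 ler_pM// ltW.
  move: qS; rewrite /spread_box; case: p; rewrite /heis_box /mkset;
    move: (heis_mul _ _) => r [/andP[x1 x2] /andP[y1 y2] /andP[z1 z2]].
    exists (hx r), (hy r), (hz r); split; rewrite ?x1 ?y1//.
      by apply: heis_eq; rewrite !heisE /hx /hy /hz /=; ring.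
    by have := tab _ _ x1 y1; rewrite ler_norml => ?; apply/andP; split; lra.
  (* The square of centre (3 t, 0) and half side t / 4 goes into the square of centre (3 t / 2, 3 t
     / 2) with the same half side. *)
  exists (2^-1 * (hx r + hy r)), (2^-1 * (hx r - hy r)), (- (2^-1 * hz r)); split.
  - by apply: heis_eq; rewrite !heisE /hx /hy /hz /=; field.
  - by apply/andP; split; lra.
  - by apply/andP; split; lra.
  - have : t ^+ 2 <= (2^-1 * (hx r + hy r)) * (2^-1 * (hx r - hy r)) by apply: tab; lra.
    by rewrite ler_norml => ?; apply/andP; split; lra.
have a0 : 0 < a by lra.
have b0 : 0 < b by lra.
have [al0 ala stE] := stair_reach a0 b0 cab.
set al := 2^-1 * a + c / b in al0 ala stE.
(* At this speed the point is passed exactly at time [t]; since a and b are at most 2 t, [l <= 4]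
   and the endpoints stay in a fixed box. *)
pose l := (a + b) / t.
have l0 : 0 <= l by rewrite divr_ge0 ?(ltW t0)//; lra.
have lt_ : l * t = a + b by rewrite /l divfK// gt_eqF.
have l4 : l <= 4 by rewrite /l ler_pdivrMr//; lra.
have abl : a + b <= l by rewrite -lt_ ler_piMr.
exists (stair_curve p k al b l); last first.
  by rewrite /stair_curve clamp01_id ?(ltW t0)// lt_ stE -E to_l1K heis_mulKV.
split; [exact: stair_curve_geodesic (ltW b0) l0|exact: stair_curve0 (ltW b0)|].
rewrite /target_box /heis_box /mkset /stair_curve clamp01_id ?lexx ?ler01// mulr1 heis_mulVK.
rewrite stair_endpoint ?(ltW b0)//; last by lra.
have b2' : b <= 2 by lra.
have al2 : al <= 2 by lra.
have hZ : `|b * (2 * al - (l - b))| <= 2 * 4.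
  rewrite normrM ler_pM//; first by rewrite gtr0_norm.
  by rewrite ler_norml; apply/andP; split; lra.
move: hZ; set Z := b * _; rewrite ler_norml => /andP[hZ1 hZ2].
by case: p {qS E}; rewrite /of_l1 !heisE /hx /hy /hz /=; split; apply/andP; split; lra.
Qed.

Lemma spread_box_measure p k (t : R) : 0 < t -> t <= 1 ->
  ((t ^+ 4 / 4)%:E <= (m^*)%mu (intermediate_set (heis_dist p) k (target_box k) t))%E.
Proof.
move=> t0 t1; have := @spread_box_intermediate p k t t0 t1.
have t20 : 0 < t ^+ 2 by rewrite exprn_gt0.
have t40 : 0 < t ^+ 4 by rewrite exprn_gt0.
case: p => /outer_ge_heis_box H; (apply: le_trans (H _ _ _); [rewrite lee_fin|lra..]).
- by rewrite [leRHS](_ : _ = t ^+ 4); [lra|field].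
- by rewrite [leRHS](_ : _ = t ^+ 4 / 4)//; field.
Qed.

Lemma target_box_measure k : m (target_box k) = (40 * 40 * 40)%:E.
Proof.
rewrite /target_box heis_lebesgue_box; [congr (_%:E); congr (_ * _ * _); lra|lra..].
Qed.

Lemma limf_esup_right_infty (f : R -> \bar R) :
  (forall A r : R, 0 < r -> exists2 t : R, 0 < t < r & (A%:E <= f t)%E) ->
  limf_esup f 0^'+ = +oo%E.
Proof.
move=> H; rewrite limf_esupE; apply/eqP; rewrite -leye_eq.
apply: le_ereal_inf_tmp => _ [V V0 <-].
move: V0; rewrite /at_right /within /= => /nbhs_ballP[r /= r0 rV].
rewrite leye_eq; apply/eqP/eqyP => A _.
have [t /andP[t0 tr] At] := H A r r0.
apply: (le_trans At); apply: ereal_sup_ubound; exists t => //.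
by apply: rV => //; rewrite /ball/= sub0r normrN gtr0_norm.
Qed.

Lemma limf_esup_right_le0 (f : R -> \bar R) :
  (forall e : R, 0 < e -> exists2 r : R, 0 < r & forall t : R, 0 < t < r -> (f t <= e%:E)%E) ->
  (limf_esup f 0^'+ <= 0)%E.
Proof.
move=> H; rewrite limf_esupE; apply/lee_addgt0Pr => e /H[r r0 fr]; rewrite add0e.
apply: (@le_trans _ _ (ereal_sup (f @` [set t | 0 < t < r]))).
  apply: ereal_inf_lbound; exists [set t | 0 < t < r] => //.
  rewrite /at_right /within /=; apply/nbhs_ballP; exists r => //= t.
  by rewrite /ball/= sub0r normrN => tr t0; rewrite t0 -(gtr0_norm t0).
by apply: ge_ereal_sup => _ [t tr <-]; exact: fr.
Qed.

Lemma powR_small (d e : R) : 0 < d -> 0 < e ->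
  exists2 r : R, 0 < r & forall t : R, 0 < t < r -> t `^ d <= e.
Proof.
move=> d0 e0; exists (e `^ d^-1); first exact: powR_gt0.
move=> t /andP[t0 tr].
have : t `^ d <= (e `^ d^-1) `^ d.
  by rewrite ge0_ler_powR ?nnegrE ?powR_ge0 ?ltW.
by rewrite -powRrM mulVf ?gt_eqF// powRr1// ltW.
Qed.

(** With W the volume of [target_box k], this single set already gives quotients of at least t^(4 -
    s) / (4 W), unbounded as t tends to 0. *)
Lemma geodesic_C_gt4 p k (s : R) : 4 < s ->
  geodesic_C (heis_dist p) m k s = +oo%E.
Proof.
move=> s4; apply/eqP; rewrite -leye_eq; apply: ereal_sup_ubound.
exists (target_box k).
  split.
  - exact: measurable_heis_box.
  - exists (10 * 40) => y z.
    rewrite /target_box /heis_box /mkset -[y](heis_mulKV k) -[z](heis_mulKV k) heis_dist_left.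
    rewrite !heis_mulVK; move: (heis_mul _ y) (heis_mul _ z) => u v.
    move=> [/andP[? ?] /andP[? ?] /andP[? ?]] [/andP[? ?] /andP[? ?] /andP[? ?]].
    apply: heis_dist_coord_le; first by [].
    - by rewrite ler_norml; apply/andP; split; lra.
    - by rewrite ler_norml; apply/andP; split; lra.
    - have uv (a b : R) : -20 <= a -> a <= 20 -> -20 <= b -> b <= 20 -> `|a * b| <= 400.
        move=> ? ? ? ?; rewrite normrM (_ : 400 = 20 * 20); last by lra.
        by rewrite ler_pM// ler_norml; apply/andP; split; lra.
      have : `|hx u * hy v| <= 400 by exact: uv.
      have : `|hx v * hy u| <= 400 by exact: uv.
      by rewrite !ler_norml => /andP[? ?] /andP[? ?]; apply/andP; split; lra.
  - by rewrite target_box_measure lte_fin ltry andbT !mulr_gt0.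
apply: limf_esup_right_infty => A r r0.
have d0 : 0 < s - 4 by lra.
have mB := target_box_measure k.
set W : R := 40 * 40 * 40 in mB; have W0 : 0 < W by rewrite !mulr_gt0.
have e0 : 0 < (4 * W * (1 + `|A|))^-1.
  by rewrite invr_gt0 !mulr_gt0// ltr_wpDr.
have [r' r'0 Hr'] := powR_small d0 e0.
pose t := Num.min (Num.min (r / 2) (r' / 2)) 1.
have t0 : 0 < t by rewrite !lt_min ltr01 andbT; apply/andP; split; lra.
have tr : t < r by rewrite !gt_min; apply/orP; left; apply/orP; left; lra.
have tr' : t < r' by rewrite !gt_min; apply/orP; left; apply/orP; right; lra.
have t1 : t <= 1 by rewrite ge_min lexx orbT.
exists t; first by rewrite t0.
have ts0 : 0 < t `^ s by exact: powR_gt0.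
apply: (@le_trans _ _ ((t `^ s)^-1%:E * ((t ^+ 4 / 4)%:E * (m (target_box k))^-1))%E); last first.
  apply: lee_wpmul2l; first by rewrite lee_fin invr_ge0 ltW.
  apply: lee_wpmul2r; last exact: spread_box_measure.
  by rewrite mB inver gt_eqF// lee_fin invr_ge0 ltW.
rewrite mB inver gt_eqF// -!EFinM lee_fin.
have := Hr' t; rewrite t0 tr' => /(_ isT).
have -> : t `^ s = t `^ (s - 4) * t ^+ 4.
  rewrite -powR_mulrn ?(ltW t0)// -powRD ?subrK//.
  by apply/implyP => _; rewrite gt_eqF.
set w := t `^ (s - 4); have w0 : 0 < w by exact: powR_gt0.
move=> hw; have t40 : 0 < t ^+ 4 by exact: exprn_gt0.
rewrite (_ : _ * _ = (w * (4 * W))^-1); last by field; rewrite !gt_eqF.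
rewrite -div1r ler_pdivlMr ?mulr_gt0//.
have A1 : A <= 1 + `|A| by have := ler_norm A; lra.
have A0 : 0 < 1 + `|A| by have := normr_ge0 A; lra.
rewrite (le_trans (_ : _ <= (1 + `|A|) * (w * (4 * W))))//.
  by rewrite ler_wpM2r// ltW// !mulr_gt0.
move: hw; rewrite -div1r ler_pdivlMr ?mulr_gt0//; apply: le_trans.
by rewrite le_eqVlt; apply/orP; left; apply/eqP; ring.
Qed.

Lemma bounded_from_origin p (Om : set (heis R)) (M : R) : Om !=set0 ->
  (forall y z, Om y -> Om z -> heis_dist p y z <= M) ->
  exists2 r : R, 0 < r & forall y, Om y -> heis_dist p (heis0 R) y <= r.
Proof.
move=> [q Oq] bd.
have M0 : 0 <= M by exact: le_trans (heis_dist_ge0 p q q) (bd _ _ Oq Oq).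
pose a := `|hx q|; pose b := `|hy q|; pose c := `|hz q|.
(* [B] dominates every coordinate of [y]; since [B >= 1], also |z| <= B^2, as [heis_dist_coord_le]
   demands. *)
pose B := 1 + a + b + c + M + 4 * M ^+ 2 + (a + M) * (b + M).
have [a0 b0 c0] : [/\ 0 <= a, 0 <= b & 0 <= c] by split; exact: normr_ge0.
have aM : 0 <= (a + M) * (b + M) by rewrite mulr_ge0// addr_ge0.
have MM := sqr_ge0 M.
have B1 : 1 <= B by rewrite /B; lra.
exists (10 * B) => [|y Oy]; first by lra.
have [h1 h2 h3] := heis_dist_coord_ge p q y.
have d0 := heis_dist_ge0 p q y; have dM := bd _ _ Oq Oy.
set d := heis_dist p q y in h1 h2 h3 d0 dM.
have hxy : `|hx y| <= a + M.
  rewrite (_ : hx y = hx q + (hx y - hx q)); last by ring.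
  by rewrite (le_trans (ler_normD _ _))// lerD2l (le_trans h1).
have hyy : `|hy y| <= b + M.
  rewrite (_ : hy y = hy q + (hy y - hy q)); last by ring.
  by rewrite (le_trans (ler_normD _ _))// lerD2l (le_trans h2).
have dd : d ^+ 2 <= M ^+ 2 by rewrite lerXn2r// nnegrE.
apply: heis_dist_coord_le; rewrite ?hx0 ?hy0 ?hz0 ?mul0r ?mulr0 ?subr0 ?mulr0 ?subr0.
- by lra.
- by rewrite (le_trans hxy)// /B; lra.
- by rewrite (le_trans hyy)// /B; lra.
- have BB : B <= B ^+ 2 by rewrite expr2 ler_peMr//; lra.
  apply: le_trans BB.
  pose T1 := hz y - hz q - 2^-1 * (hx q * hy y - hx y * hy q).
  pose T2 := 2^-1 * (hx q * hy y); pose T3 := 2^-1 * (hx y * hy q).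
  rewrite (_ : hz y = hz q + T1 + T2 - T3); last by rewrite /T1 /T2 /T3; ring.
  have e1 : `|T2| <= 2^-1 * ((a + M) * (b + M)).
    by rewrite !normrM (ger0_norm (_ : 0 <= 2^-1))// ler_pM2l// ler_pM// lerDl.
  have e2 : `|T3| <= 2^-1 * ((a + M) * (b + M)).
    by rewrite !normrM (ger0_norm (_ : 0 <= 2^-1))// ler_pM2l// ler_pM// lerDl.
  have n1 := ler_normB (hz q + T1 + T2) T3; have n2 := ler_normD (hz q + T1) T2.
  have n3 := ler_normD (hz q) T1; rewrite -/T1 in h3.
  by apply: (le_trans n1); rewrite /B; move: n2 n3 h3 e1 e2 dd; rewrite -/c; lra.
Qed.

Lemma dist_box p k q (r : R) : heis_dist p k q <= r ->
  heis_box k (- r) r (- r) r (- (4 * r ^+ 2)) (4 * r ^+ 2) q.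
Proof.
move=> dr; have [] := heis_dist_coord_ge p k q.
have d0 := heis_dist_ge0 p k q.
rewrite /heis_box /mkset hz_mulVl hx_mul hy_mul hx_inv hy_inv ![- _ + _]addrC -!ler_norml.
move=> h1 h2 h3; split; [exact: le_trans dr|exact: le_trans dr|].
apply: (le_trans h3); rewrite ler_pM2l// lerXn2r// nnegrE//.
exact: le_trans dr.
Qed.

(** If [Om] lies within r of the origin, its intermediate set at time t lies within t r, hence in a
    box of volume 2 * 2 * 8 * (t r)^4; divided by t^s this tends to 0. *)
Lemma geodesic_C_lt4 p (s : R) : 0 < s -> s < 4 ->
  (geodesic_C (heis_dist p) m (heis0 R) s <= 0)%E.
Proof.
move=> s0 s4; apply: ge_ereal_sup => _ [Om [mO [M bd] /andP[mO0 mOoo]] <-].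
have O0 : Om !=set0.
  by apply/set0P/eqP => OE; move: mO0; rewrite OE measure0 ltxx.
have [r r0 Or] := bounded_from_origin O0 bd.
have [w w0 mOw] : exists2 w : R, 0 < w & m Om = w%:E.
  by exists (fine (m Om)); [rewrite fine_gt0// mO0|rewrite fineK// ge0_fin_numE// ltW].
apply: limf_esup_right_le0 => e e0.
have d0 : 0 < 4 - s by lra.
pose C := 32 * r ^+ 4 / w; have C0 : 0 < C by rewrite divr_gt0// mulr_gt0// exprn_gt0.
have [r' r'0 Hr'] := powR_small d0 (divr_gt0 e0 C0).
exists (Num.min r' 1) => [|t /andP[t0]]; first by rewrite lt_min r'0 ltr01.
rewrite lt_min => /andP[tr' t1].
have box : intermediate_set (heis_dist p) (heis0 R) Om t `<=`
    heis_box (heis0 R) (- (t * r)) (t * r) (- (t * r)) (t * r)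
      (- (4 * (t * r) ^+ 2)) (4 * (t * r) ^+ 2).
  move=> _ [g [[geo _] g0 g1] <-]; apply: (@dist_box p).
  have := geo 0 t; rewrite lexx ler01 (ltW t0) (ltW t1) g0 subr0 => /(_ isT isT) ->.
  by rewrite (gtr0_norm t0) ler_pM2l// Or.
have tr0 : 0 < t * r by rewrite mulr_gt0.
have tr20 : 0 < (t * r) ^+ 2 by rewrite exprn_gt0.
have := outer_le_heis_box _ _ _ box.
move=> /(_ ltac:(lra) ltac:(lra) ltac:(lra)) out.
have ts0 : 0 < t `^ s by exact: powR_gt0.
rewrite mOw inver gt_eqF//.
apply: (@le_trans _ _ ((t `^ s)^-1%:E * ((32 * (t * r) ^+ 4)%:E * w^-1%:E))%E).
  apply: lee_wpmul2l; first by rewrite lee_fin invr_ge0 ltW.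
  apply: lee_wpmul2r; first by rewrite lee_fin invr_ge0 ltW.
  apply: (le_trans out); rewrite lee_fin le_eqVlt; apply/orP; left; apply/eqP; ring.
rewrite -!EFinM lee_fin.
have := Hr' t; rewrite t0 tr' => /(_ isT); rewrite ler_pdivlMr//; apply: le_trans.
have t4E : t ^+ 4 = t `^ (4 - s) * t `^ s.
  rewrite -powRD ?subrK ?powR_mulrn ?(ltW t0)//.
  by apply/implyP => _; rewrite gt_eqF.
rewrite exprMn t4E /C le_eqVlt; apply/orP; left; apply/eqP.
by field; rewrite !gt_eqF.
Qed.

Theorem geodesic_dim_heis p : geodesic_dim (heis_dist (R := R) p) m = 4%:E.
Proof.
have le4 k : (geodesic_dim_at (heis_dist p) m k <= 4%:E)%E.
  apply/lee_addgt0Pr => e e0; apply: ereal_inf_lbound; exists (4 + e) => //.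
  by split; [lra|apply: geodesic_C_gt4; lra].
apply/eqP; rewrite eq_le; apply/andP; split.
  by apply: ge_ereal_sup => _ [k _ <-]; exact: le4.
apply: (@le_trans _ _ (geodesic_dim_at (heis_dist p) m (heis0 R))); last first.
  by apply: ereal_sup_ubound; exists (heis0 R).
apply: le_ereal_inf_tmp => _ [s [s0 sC] <-]; rewrite lee_fin leNgt.
by apply/negP => /(geodesic_C_lt4 p s0); rewrite sC leye_eq.
Qed.

End geodesic_dimension.

(** * Hausdorff dimension *)

(** The left side is the number of cells that cover [big_box n] at mesh 1 / M, where k = n M; each
    factor absorbs its extra 1, and 45 = 5 * 3 * 3. *)
Lemma grid_count (k : nat) : (0 < k)%N ->
  ((4 * k ^ 2).+1 * (2 * k).+1 * (2 * k).+1 <= 45 * k ^ 4)%N.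
Proof.
move=> k0.
have -> : (45 * k ^ 4 = (5 * k ^ 2) * (3 * k) * (3 * k))%N by rewrite !expnS expn0; ring.
have h : ((2 * k).+1 <= 3 * k)%N by rewrite [(3 * _)%N]mulSn addnC -addn1 leq_add2l.
have h2 : ((4 * k ^ 2).+1 <= 5 * k ^ 2)%N.
  by rewrite [(5 * _)%N]mulSn addnC -addn1 leq_add2l expn_gt0 k0.
exact: leq_mul (leq_mul h2 h) h.
Qed.

Section hausdorff_dimension.
Variable R : realType.
Notation m := (heis_lebesgue R).
Implicit Types (g h k : heis R) (p : exponent1oo).

Lemma ediam_ge0 (X : Type) (d : X -> X -> R) (U : set X) : (0 <= ediam d U)%E.
Proof. by apply: ereal_sup_ubound; right. Qed.

Lemma ediam_le (X : Type) (d : X -> X -> R) (U : set X) (r : R) : 0 <= r ->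
  (forall x y, U x -> U y -> d x y <= r) -> (ediam d U <= r%:E)%E.
Proof.
move=> r0 Ur; apply: ge_ereal_sup => _ [[[x y] [/= Ux Uy] <-]|->]; rewrite lee_fin//.
exact: Ur.
Qed.

Lemma le_ediam (X : Type) (d : X -> X -> R) (U : set X) x y : U x -> U y ->
  ((d x y)%:E <= ediam d U)%E.
Proof. by move=> Ux Uy; apply: ereal_sup_ubound; left; exists (x, y). Qed.

Lemma ediam0 (X : Type) (d : X -> X -> R) : ediam d set0 = 0%E.
Proof.
by apply/eqP; rewrite eq_le ediam_ge0 andbT; apply: (@ediam_le _ _ _ 0).
Qed.

(** [U] lies in the ball of radius its diameter D about any of its points, of volume at most 32 D^4,
    and D^4 <= D^s because D <= 1. *)
Lemma outer_le_ediam p (U : set (heis R)) (s : R) : 0 < s -> s <= 4 ->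
  (ediam (heis_dist p) U <= 1)%E ->
  ((m^*)%mu U <= 32%:E * ediam (heis_dist p) U `^ s)%E.
Proof.
move=> s0 s4 U1; have U0 := ediam_ge0 (heis_dist p) U.
have [->|/set0P[u Uu]] := eqVneq U set0.
  by rewrite mu_ext0// mule_ge0// poweR_ge0.
have [D DE] : exists D : R, ediam (heis_dist p) U = D%:E.
  exists (fine (ediam (heis_dist p) U)); rewrite fineK// ge0_fin_numE//.
  by rewrite (le_lt_trans U1)// ltry.
rewrite DE !lee_fin in U0 U1 *.
have box : U `<=` heis_box u (- D) D (- D) D (- (4 * D ^+ 2)) (4 * D ^+ 2).
  by move=> v Uv; apply: (@dist_box _ p); rewrite -lee_fin -DE; exact: le_ediam.
have D20 := sqr_ge0 D.
apply: (le_trans (outer_le_heis_box _ _ _ box)); [lra|lra|lra|].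
rewrite poweR_EFin -EFinM lee_fin [leLHS](_ : _ = 32 * D ^+ 4); last by ring.
rewrite ler_pM2l//; move: U0; rewrite le_eqVlt => /predU1P[<-|D0].
  by rewrite expr0n/= powR_ge0.
by rewrite -powR_mulrn ?(ltW D0)// ger_powR// D0.
Qed.

Lemma heis_lebesgueT : m setT = +oo%E.
Proof.
apply/eqyP => A A0.
pose B := heis_box (heis0 R) 0 A 0 1 0 1.
apply: (@le_trans _ _ (m B)).
  by rewrite heis_lebesgue_box ?ler01 ?(ltW A0)// !subr0 !mulr1.
by apply: le_measure => //; rewrite inE//; exact: measurable_heis_box.
Qed.

(** Mass distribution: in a cover by sets of diameter at most 1, the sum of the diam^s is at least
    1/32 of the total volume, which is infinite. *)
Lemma hausdorff_measure_neq0 p (s : R) : 0 < s -> s <= 4 ->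
  hausdorff_measure (heis_dist (R := R) p) s setT <> 0%E.
Proof.
move=> s0 s4 H0.
have : (+oo <= hausdorff_measure (heis_dist (R := R) p) s setT)%E; last by rewrite H0.
apply: (@le_trans _ _ (hausdorff_premeasure (heis_dist (R := R) p) s 1 setT)); last first.
  by apply: ereal_sup_ubound; exists 1 => //=.
apply: le_ereal_inf_tmp => _ [U [cU dU] <-].
have h : (+oo <= \sum_(i <oo) (32%:E * ediam (heis_dist p) (U i) `^ s))%E.
  have -> : (+oo = (m^*)%mu setT)%E.
    by rewrite measurable_mu_extE//; rewrite -[RHS]/(m _) heis_lebesgueT.
  apply: le_trans (le_mu_ext m cU) _.
  apply: le_trans (mu_ext_sigma_subadditive (measure_ge0 m) U) _.
  by apply: lee_nneseries => [i _ _|i _]; [exact: (mu_ext_ge0 (measure_ge0 m))|exact: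
    outer_le_ediam].
rewrite nneseriesZl in h; last by move=> i _; exact: poweR_ge0.
move: h; rewrite !leye_eq => /eqP h; apply/eqP.
have : (0 <= \sum_(i <oo) ediam (heis_dist p) (U i) `^ s)%E.
  by apply: nneseries_ge0 => i _ _; exact: poweR_ge0.
by move: h; case: (limn _) => // r; rewrite -EFinM.
Qed.

(* The premeasure of Hausdorff as the outer measure generated by a set function
   defined on all subsets, so that countable subadditivity comes for free. *)
Definition all_sets : Type := g_sigma_algebraType (setT : set (set (heis R))).

(** The value +oo on sets of large diameter excludes them from every cover of finite cost, which
    encodes the constraint of [hausdorff_premeasure]. *)
Definition gauge p (s delta : R) (U : set all_sets) : \bar R :=
  if (ediam (heis_dist p) (U : set (heis R)) <= delta%:E)%E
  then (ediam (heis_dist p) (U : set (heis R)) `^ s)%E else +oo%E.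

Lemma gauge_ge0 p (s delta : R) U : (0 <= gauge p s delta U)%E.
Proof. by rewrite /gauge; case: ifP => // _; exact: poweR_ge0. Qed.

Lemma measurable_all_sets (U : set all_sets) : measurable U.
Proof. exact: sub_sigma_algebra. Qed.

Lemma hausdorff_premeasure_eq0 p (s delta : R) (A : set (heis R)) :
  mu_ext (gauge p s delta) A = 0%E ->
  hausdorff_premeasure (heis_dist p) s delta A = 0%E.
Proof.
move=> A0; apply/eqP; rewrite eq_le; apply/andP; split; last first.
  apply: le_ereal_inf_tmp => _ [U _ <-].
  by apply: nneseries_ge0 => i _ _; exact: poweR_ge0.
apply/lee_addgt0Pr => e e0; rewrite add0e.
have : (mu_ext (gauge p s delta) A < e%:E)%E by rewrite A0 lte_fin.
move=> /ereal_inf_lt[_ [U [_ AU] <-] Ue].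
have gU i : gauge p s delta (U i) = (ediam (heis_dist p) (U i) `^ s)%E /\
    (ediam (heis_dist p) (U i) <= delta%:E)%E.
  rewrite /gauge; case: ifPn => [//|nU]; exfalso.
  have gi : gauge p s delta (U i) = +oo%E by rewrite /gauge (negbTE nU).
  move: Ue; rewrite (eseries_pinfty _ _ gi)// => j _.
  by rewrite gt_eqF// (lt_le_trans _ (gauge_ge0 _ _ _ _)).
apply: le_trans (ltW Ue).
apply: ereal_inf_lbound; exists U; first by split=> // i; have [] := gU i.
by apply: eq_eseriesr => i _; have [] := gU i.
Qed.

Lemma nneseries_le_count (f : nat -> \bar R) (n : nat) (e : R) :
  (forall i, (0 <= f i)%E) -> (forall i, (i < n)%N -> (f i <= e%:E)%E) ->
  (forall i, (n <= i)%N -> f i = 0%E) ->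
  (\sum_(i <oo) f i <= (n%:R * e)%:E)%E.
Proof.
move=> f0 fe fn; rewrite (nneseries_split 0 n)// eseries0 ?adde0; last first.
  by move=> i; rewrite add0n => ni _; exact: fn.
apply: (@le_trans _ _ (\sum_(0 <= i < 0 + n) e%:E)%E).
  rewrite big_nat_cond [leRHS]big_nat_cond; apply: lee_sum => i.
  by rewrite andbT add0n => /andP[_ /fe].
by rewrite sumEFin big_const_nat iter_addr_0 subn0 add0n mulr_natl.
Qed.

(** The height r^2 matches the area swept within a square of side r; [heis_dist_coord_le] then
    applies with radius 2 r. *)
Lemma heis_box_dist p k (r z : R) u v : 0 <= r ->
  heis_box k 0 r 0 r z (z + r ^+ 2) u -> heis_box k 0 r 0 r z (z + r ^+ 2) v ->
  heis_dist p u v <= 20 * r.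
Proof.
move=> r0; rewrite /heis_box /mkset -[u](heis_mulKV k) -[v](heis_mulKV k) heis_dist_left.
rewrite !heis_mulVK.
move: (heis_mul _ u) (heis_mul _ v) => {}u {}v.
move=> [/andP[? ?] /andP[? ?] /andP[? ?]] [/andP[? ?] /andP[? ?] /andP[? ?]].
rewrite (_ : 20 * r = 10 * (2 * r)); last by ring.
have uv (a b : R) : 0 <= a -> a <= r -> 0 <= b -> b <= r -> 0 <= a * b <= r ^+ 2.
  by move=> ? ? ? ?; rewrite mulr_ge0// expr2 ler_pM.
have /andP[? ?] : 0 <= hx u * hy v <= r ^+ 2 by exact: uv.
have /andP[? ?] : 0 <= hx v * hy u <= r ^+ 2 by exact: uv.
have ? := sqr_ge0 r.
apply: heis_dist_coord_le; rewrite ?exprMn ?ler_norml; [lra|apply/andP; split; lra..].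
Qed.

(** Cells are left translates, sheared along with their column, so that all have diameter of order 1
    / M. The offset 2 n^2 makes room for |z| <= n^2 plus a shear of at most n^2. *)
Definition grid_cell (n M : nat) (a b c : nat) : set (heis R) :=
  heis_box (a%:R / M%:R - n%:R, b%:R / M%:R - n%:R, 0) 0 M%:R^-1 0 M%:R^-1
    (c%:R / M%:R ^+ 2 - 2 * n%:R ^+ 2) (c%:R / M%:R ^+ 2 - 2 * n%:R ^+ 2 + M%:R^-1 ^+ 2).

Definition big_box (n : nat) : set (heis R) :=
  [set g | [/\ `|hx g| <= n%:R, `|hy g| <= n%:R & `|hz g| <= n%:R]].

Lemma truncn_cell (M x : R) : 0 < M -> 0 <= x ->
  0 <= x - (Num.truncn (M * x))%:R / M <= M^-1.
Proof.
move=> M0 x0; have Mx : 0 <= M * x by rewrite mulr_ge0// ltW.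
have /andP[h1 h2] := truncn_itv Mx.
rewrite subr_ge0 ler_pdivrMr// [x * M]mulrC h1/= lerBlDr.
rewrite -[X in X + _]mul1r -mulrDl ler_pdivlMr// [x * M]mulrC ltW//.
by rewrite -natr1 addrC in h2.
Qed.

Lemma big_box_grid (n M : nat) g : (0 < n)%N -> (0 < M)%N -> big_box n g ->
  exists a b c : nat, [/\ (a < (2 * (n * M)).+1)%N, (b < (2 * (n * M)).+1)%N,
    (c < (4 * (n * M) ^ 2).+1)%N & grid_cell n M a b c g].
Proof.
move=> n0 M0 [gx gy gz].
have n1 : 1 <= n%:R :> R by rewrite ler1n.
have M0' : 0 < M%:R :> R by rewrite ltr0n.
move: gx gy gz; rewrite !ler_norml => /andP[x1 x2] /andP[y1 y2] /andP[z1 z2].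
pose x := hx g + n%:R; pose y := hy g + n%:R.
have x0 : 0 <= x by rewrite /x; lra.
have y0 : 0 <= y by rewrite /y; lra.
pose a := Num.truncn (M%:R * x); pose b := Num.truncn (M%:R * y).
have /andP[ax1 ax2] := truncn_cell M0' x0; rewrite -/a in ax1 ax2.
have /andP[by1 by2] := truncn_cell M0' y0; rewrite -/b in by1 by2.
have M20 : 0 < M%:R ^+ 2 :> R by rewrite exprn_gt0.
pose xa : R := a%:R / M%:R - n%:R; pose yb : R := b%:R / M%:R - n%:R.
(* The height seen from the base point of the column, shifted into [0, 4 n^2]; steps of 1 / M^2 give
   4 (n M)^2 levels, and one more for the upper end. *)
pose z := hz g - 2^-1 * (xa * hy g - hx g * yb) + 2 * n%:R ^+ 2.
have aM0 : 0 <= a%:R / M%:R :> R by rewrite divr_ge0.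
have bM0 : 0 <= b%:R / M%:R :> R by rewrite divr_ge0.
have bnd (u v : R) : - n%:R <= u -> u <= n%:R -> - n%:R <= v -> v <= n%:R ->
    - (n%:R ^+ 2) <= u * v <= n%:R ^+ 2.
  move=> ? ? ? ?; rewrite -ler_norml normrM expr2 ler_pM// ler_norml; apply/andP; split; lra.
have /andP[e1 e2] : - (n%:R ^+ 2) <= xa * hy g <= n%:R ^+ 2.
  by apply: bnd; rewrite /xa /x in ax1 ax2 *; lra.
have /andP[e3 e4] : - (n%:R ^+ 2) <= hx g * yb <= n%:R ^+ 2.
  by apply: bnd; rewrite /yb /y in by1 by2 *; lra.
have nn : (n%:R : R) <= n%:R ^+ 2 by rewrite expr2 ler_peMr//; lra.
have z0 : 0 <= z by rewrite /z; lra.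
have z4 : z <= 4 * n%:R ^+ 2 by rewrite /z; lra.
pose c := Num.truncn (M%:R ^+ 2 * z).
have /andP[cz1 cz2] := truncn_cell M20 z0; rewrite -/c in cz1 cz2.
have ltS (N : nat) (u : R) : u <= N%:R -> (Num.truncn u < N.+1)%N.
  by move=> uN; rewrite ltnS truncn_le_nat (le_lt_trans uN)// ltr_nat.
exists a, b, c; split.
- apply: ltS; rewrite !natrM mulrC mulrA ler_pM2r//; rewrite /x; lra.
- apply: ltS; rewrite !natrM mulrC mulrA ler_pM2r//; rewrite /y; lra.
- apply: ltS; rewrite natrM natrX natrM exprMn mulrA mulrC ler_pM2r//.
- rewrite /grid_cell /heis_box /mkset hz_mulVl hx_mul hy_mul hx_inv hy_inv.
  rewrite (_ : hx (_, _, _) = xa)// (_ : hy (_, _, _) = yb)//.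
  rewrite (_ : hz (_, _, _) = 0)// subr0.
  rewrite -exprVn in cz2; rewrite /x in ax1 ax2; rewrite /y in by1 by2.
  by split; apply/andP; split; rewrite /xa /yb; move: cz1 cz2; rewrite /z /xa /yb; lra.
Qed.

Lemma gauge_grid_cell p (s delta : R) (n M a b c : nat) : 0 < s ->
  20 * M%:R^-1 <= delta ->
  (gauge p s delta (grid_cell n M a b c) <= ((20 * M%:R^-1) `^ s)%:E)%E.
Proof.
move=> s0 Md; have r0 : 0 <= M%:R^-1 :> R by rewrite invr_ge0.
have dE : (ediam (heis_dist p) (grid_cell n M a b c) <= (20 * M%:R^-1)%:E)%E.
  apply: ediam_le => [|u v Uu Uv]; first by rewrite mulr_ge0.
  exact: heis_box_dist Uu Uv.
rewrite /gauge ifT; last by rewrite (le_trans dE)// lee_fin.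
rewrite -poweR_EFin; apply: gt0_ler_poweR => //; first exact: ltW.
- by rewrite in_itv/= ediam_ge0 leey.
- by rewrite in_itv/= lee_fin mulr_ge0//= leey.
Qed.

(** About n^4 M^4 cells of diameter at most 20 / M cost at most C M^(4 - s), which is as small as
    wanted for large M. *)
Lemma mu_ext_big_box p (s delta : R) (n : nat) : 4 < s -> 0 < delta -> (0 < n)%N ->
  mu_ext (gauge p s delta) (big_box n) = 0%E.
Proof.
move=> s4 d0 n0; apply/eqP; rewrite eq_le mu_ext_ge0 ?andbT; last exact: gauge_ge0.
apply/lee_addgt0Pr => e e0; rewrite add0e.
have s0 : 0 < s by lra.
have n0' : 0 < n%:R :> R by rewrite ltr0n.
pose C : R := 45 * n%:R ^+ 4 * 20 `^ s.
have C0 : 0 < C by rewrite !mulr_gt0 ?exprn_gt0 ?powR_gt0.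
have [|r0 r00 Hr] := @powR_small R (s - 4) (e / C) _ (divr_gt0 e0 C0); first by lra.
(* The first bound makes the cost less than [e], the second makes the cells admissible for
   [delta]. *)
pose M := (Num.truncn (Num.max r0^-1 (20 / delta))).+1.
have M0 : (0 < M)%N by [].
have M0' : 0 < M%:R :> R by rewrite ltr0n.
have : Num.max r0^-1 (20 / delta) < M%:R by exact: truncnS_gt.
rewrite gt_max => /andP[M1 M2].
pose r : R := M%:R^-1; have rr : 0 < r by rewrite invr_gt0.
have rr0 : r < r0 by rewrite -[r0]invrK ltf_pV2// ?posrE ?invr_gt0.
have rd : 20 * r <= delta.
  by move: M2; rewrite ltr_pdivrMr// => M2; rewrite ler_pdivrMr// mulrC ltW// mulrC.
pose A := (2 * (n * M)).+1; pose B := (4 * (n * M) ^ 2).+1.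
pose N := (B * A * A)%N.
(* The triple (a, b, c) is coded by the index (c A + b) A + a. *)
pose U i : set (heis R) := if (i < N)%N
  then grid_cell n M (i %% A) (i %/ A %% A) (i %/ A %/ A) else set0.
have cU : big_box n `<=` \bigcup_i U i.
  move=> g /(big_box_grid n0 M0)[a [b [c [aA bA cB gc]]]].
  have iN : ((c * A + b) * A + a < N)%N.
    rewrite -/A in aA bA; rewrite -/B in cB; rewrite /N.
    apply: (@leq_trans (((c * A + b).+1) * A)%N); first by rewrite mulSn addnC ltn_add2r.
    rewrite leq_mul2r; apply/orP; right.
    apply: (@leq_trans ((c.+1) * A)%N); first by rewrite mulSn addnC ltn_add2r.
    by rewrite leq_mul2r cB orbT.
  exists ((c * A + b) * A + a)%N => //; rewrite /U iN.
  by rewrite modnMDl modn_small// divnMDl// (divn_small aA) addn0 modnMDl modn_small//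
    divnMDl// (divn_small bA) addn0.
apply: (@le_trans _ _ (\sum_(i <oo) gauge p s delta (U i))%E).
  apply: ereal_inf_lbound; exists U => //; split=> // i.
  exact: measurable_all_sets.
apply: (@le_trans _ _ (N%:R * (20 * r) `^ s)%:E).
  apply: nneseries_le_count.
  - by move=> i; exact: gauge_ge0.
  - by move=> i iN; rewrite /U iN; exact: gauge_grid_cell.
  - move=> i; rewrite leqNgt => /negbTE iN; rewrite /U iN /gauge ediam0 lee_fin (ltW d0).
    by rewrite poweR0r// gt_eqF.
rewrite lee_fin powRM ?(ltW rr)//.
have NE : (N <= 45 * (n * M) ^ 4)%N.
  by apply: grid_count; rewrite muln_gt0 n0.
have Nr : N%:R <= 45 * n%:R ^+ 4 * r ^- 4.
  rewrite /r exprVn invrK -mulrA -exprMn -natrM -natrX -natrM ler_nat.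
  exact: NE.
have := Hr r; rewrite rr rr0 => /(_ isT); rewrite ler_pdivlMr// => hr.
apply: le_trans hr.
have -> : r `^ s = r `^ (s - 4) * r ^+ 4.
  rewrite -powR_mulrn ?(ltW rr)// -powRD ?subrK//.
  by apply/implyP => _; rewrite gt_eqF.
apply: (@le_trans _ _ (45 * n%:R ^+ 4 * r ^- 4 * (20 `^ s * (r `^ (s - 4) * r ^+ 4)))).
  by rewrite ler_wpM2r// !mulr_ge0 ?powR_ge0 ?exprn_ge0 ?(ltW rr).
rewrite /C le_eqVlt; apply/orP; left; apply/eqP; field.
by rewrite gt_eqF.
Qed.

Lemma hausdorff_measure_gt4 p (s : R) : 4 < s ->
  hausdorff_measure (heis_dist (R := R) p) s setT = 0%E.
Proof.
move=> s4; apply/eqP; rewrite eq_le; apply/andP; split; last first.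
  apply: (@le_trans _ _ (hausdorff_premeasure (heis_dist (R := R) p) s 1 setT)); last first.
    by apply: ereal_sup_ubound; exists 1 => //=.
  apply: le_ereal_inf_tmp => _ [U _ <-].
  by apply: nneseries_ge0 => i _ _; exact: poweR_ge0.
apply: ge_ereal_sup => _ [delta /= d0 <-].
rewrite (@hausdorff_premeasure_eq0 p s delta)//.
apply/eqP; rewrite eq_le mu_ext_ge0 ?andbT; last exact: gauge_ge0.
(* The boxes are indexed by [n.+1] because [mu_ext_big_box] requires a positive size. *)
have cT : [set: all_sets] `<=` \bigcup_n (big_box n.+1 : set all_sets).
  move=> g _; pose t := Num.max (Num.max `|hx g| `|hy g|) `|hz g|.
  exists (Num.truncn t) => //; have := truncnS_gt t; rewrite /t !gt_max.
  by move=> /andP[/andP[? ?] ?]; split; exact: ltW.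
apply: (le_trans (le_mu_ext _ cT)).
apply: (le_trans (mu_ext_sigma_subadditive (gauge_ge0 p s delta) _)).
by rewrite eseries0// => i _ _; exact: mu_ext_big_box.
Qed.

Theorem hausdorff_dim_heis p : hausdorff_dim (heis_dist (R := R) p) = 4%:E.
Proof.
apply/eqP; rewrite eq_le; apply/andP; split.
  apply/lee_addgt0Pr => e e0; apply: ereal_inf_lbound; exists (4 + e) => //.
  by split; [lra|apply: hausdorff_measure_gt4; lra].
apply: le_ereal_inf_tmp => _ [s [s0 sH] <-]; rewrite lee_fin leNgt; apply/negP => s4.
exact: (hausdorff_measure_neq0 s0 (ltW s4) sH).
Qed.

End hausdorff_dimension.

Theorem theoremC (R : realType) (p : exponent1oo) :
  (forall K N : R, MCP_pair K N ->
     ~ MCP (heis_dist (R := R) p) (heis_lebesgue R) K N) /\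
  geodesic_dim (heis_dist (R := R) p) (heis_lebesgue R) = 4%:E /\
  geodesic_dim (heis_dist (R := R) p) (heis_lebesgue R)
    = hausdorff_dim (heis_dist (R := R) p).
Proof.
split; first by move=> K N; exact: not_MCP.
by rewrite geodesic_dim_heis hausdorff_dim_heis.
Qed.
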